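(* Let $G$ be a strictly linear-recursive coarse-grained workflow specification and let $R$ be a regular path query that is safe with respect to $G$. Let $g\in L(G)$ be any run, of size $n$, and let $u,v$ be nodes of $g$. Given $G$ and the labels $\psi_V(u)$ and $\psi_V(v)$, the pairwise query $R$ on $(u,v)$, i.e. whether $u\stackrel{R}{\leadsto}v$ holds in $g$, can be answered in constant time. Constant time is with respect to the run size $n$ (with $G$ and $R$ regarded as fixed), assuming that any operation on two words of $\log n$ bits takes constant time.
   Context: **Workflows.** A simple workflow $W=(V,E)$ is a finite acyclic directed multigraph. Each node (module) has a name in a finite set $\Sigma$ and each edge $e$ has a tag $\tau_E(e)$ in a finite set $\Gamma$; parallel edges carry different tags. A workflow specification is a graph grammar $G=(\Sigma,\Delta,S,P)$, where $\Delta\subseteq\Sigma$ are the composite modules, $\Sigma\setminus\Delta$ the atomic modules, $S\in\Sigma$ is the start module, and $P$ is a finite set of productions $M\to W$ with $M\in\Delta$ and $W$ a simple workflow with node names in $\Sigma$. Coarse-grained means that every module has a single input and a single output and the output depends on the input; so each right-hand side $W$ has a unique source and a unique sink. Replacing a composite node $v$ by $W$ (for a production $name(v)\to W$) deletes $v$, inserts a copy of $W$, redirects the edges entering $v$ to the source of $W$ and lets the edges leaving $v$ start at the sink of $W$, keeping tags. An execution of a module $M$ is a graph with only atomic nodes obtained from a single node named $M$ by a sequence of replacements; its input is its source node and its output is its sink node. A run of $G$ is an execution of $S$; $L(G)$ is the set of runs. **Strict linear recursion.** The production graph $\mathcal P(G)$ is the directed multigraph with vertex set $\Sigma$ having, for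 each production $M\to W$ and each node of $W$ named $M'$, one edge from $M$ to $M'$. $G$ is strictly linear-recursive if all cycles of $\mathcal P(G)$ are vertex-disjoint. A module is recursive if it lies on a cycle. **Queries.** A regular path query $R$ is a regular expression over $\Gamma$ (built from $\epsilon$, the single-symbol wildcard, symbols, concatenation, alternation, $^*$, $^+$) with language $L(R)\subseteq\Gamma^*$. For a path $p$ with edges $e_1,\dots,e_k$ let $\tau_P(p)=\tau_E(e_1)\cdots\tau_E(e_k)$. Write $u\stackrel{R}{\leadsto}v$ if there is a path $p$ from $u$ to $v$ in $g$ with $\tau_P(p)\in L(R)$. **Safety.** A DFA $\mathcal M=(Q,\Gamma,\delta,q_0,F)$ has a total transition function $\delta:Q\times\Gamma\to Q$, extended to $\delta^*:Q\times\Gamma^*\to Q$. $\mathcal M$ is safe with respect to $G$ if for every $(q_1,q_2)\in Q\times Q$, every $M\in\Sigma$ and any two executions $ex_1,ex_2$ of $M$: if some path $p$ from the input to the output of $M$ in $ex_1$ has $\delta^*(q_1,\tau_P(p))=q_2$, then some path $p'$ from the input to the output of $M$ in $ex_2$ has $\delta^*(q_1,\tau_P(p'))=q_2$. $R$ is safe with respect to $G$ if some DFA accepting $L(R)$ is safe with respect to $G$. **Labels $\psi_V$.** Fix an ordering of the productions, a topological ordering of the nodes of each right-hand side, an ordering of the cycles of $\mathcal P(G)$, and a first edge for each cycle. The edge of $\mathcal P(G)$ from $M$ to the $i$-th node of the right-hand side of the $k$-th production (with left-hand side $M$) is identified with the pair $(k,i)$. The compressed parse tree $T$ of a run records its derivation: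 leaves are the atomic nodes of the run, and internal nodes are composite nodes occurring in the derivation or special recursive nodes. The children of a composite node $x$ correspond to the nodes of the right-hand side that replaced $x$, with the following modification for recursion. Whenever a node $x_1$ with a recursive module name is created that does not continue an already started recursion, a recursive node is put in its place, whose children are $x_1,x_2,\dots,x_m$, where $x_{j+1}$ is the node in the replacement of $x_j$ corresponding to the next edge of the cycle (and $x_{j+1}$ is then not a child of $x_j$), the sequence ending when the production applied does not contain the next cycle edge. A tree edge from a composite node $x$ to its child is labeled $(k,i)$ if the child (or, for a recursive node, its first child $x_1$) is the $i$-th node of the right-hand side of the $k$-th production, used to replace $x$. A tree edge from a recursive node to its $i$-th child is labeled $(s,t,i)$ if the recursion unfolds the $s$-th cycle starting from the $t$-th edge of that cycle. The label $\psi_V(v)$ of a node $v$ is the sequence of edge labels on the path from the root of $T$ to $v$. *)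

(* Defs.v *)
From HB Require Import structures.
From mathcomp Require Import all_boot.
From mathcomp Require Import finmap.

Set Implicit Arguments.
Unset Strict Implicit.
Unset Printing Implicit Defensive.

Local Open Scope fset_scope.

(** * Tagged multigraphs *)

(* An edge is (origin, tag, target): a set of such triples is a multigraph
   whose parallel edges carry different tags. *)
Section Multigraph.
Variables (V : eqType) (Gamma : Type).
Implicit Types (E : {pred V * Gamma * V}) (p : seq (V * Gamma * V)).

Fixpoint is_path E (x : V) p (y : V) : bool :=
  if p is e :: p' then [&& e \in E, e.1.1 == x & is_path E e.2 p' y]
  else x == y.

Definition path_tags p : seq Gamma := [seq e.1.2 | e <- p].

Definition acyclic E : Prop := forall x p, is_path E x p x -> p = [::].

Definition is_source E (x : V) : Prop := forall e, e \in E -> e.2 != x.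
Definition is_sink E (x : V) : Prop := forall e, e \in E -> e.1.1 != x.
End Multigraph.

(** * Workflow specifications *)

Record workflow (Sigma Gamma : finType) := Workflow {
  wnode : finType;
  wname : wnode -> Sigma;
  wedges : {set wnode * Gamma * wnode};
  wacyclic : acyclic (mem wedges) }.

Record grammar (Sigma Gamma : finType) := Grammar {
  composite : {set Sigma};
  start : Sigma;
  production : finType;
  lhs : production -> Sigma;
  rhs : production -> workflow Sigma Gamma;
  lhs_composite : forall k, lhs k \in composite }.

Section Grammar.
Variables (Sigma Gamma : finType) (G : grammar Sigma Gamma).
Implicit Types (k : production G) (M : Sigma).

Definition source_of k (x : wnode (rhs k)) : Prop :=
  is_source (mem (wedges (rhs k))) x.
Definition sink_of k (x : wnode (rhs k)) : Prop :=
  is_sink (mem (wedges (rhs k))) x.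

Definition coarse_grained : Prop :=
  forall k, (exists! x, @source_of k x) /\ (exists! x, @sink_of k x).

(** ** Production graph *)

(* The edges of the production graph, from [pe_src e] to [pe_dst e]: a
   production together with a node of its right-hand side. *)
Definition pedge : finType := {k : production G & wnode (rhs k)}.
Definition pe_src (e : pedge) : Sigma := lhs (tag e).
Definition pe_dst (e : pedge) : Sigma := wname (tagged e).

Definition is_cycle (c : seq pedge) : bool :=
  [&& c != [::], cycle [rel e f | pe_dst e == pe_src f] c
    & uniq [seq pe_src e | e <- c]].

(* The edge at which the enumeration of a cycle begins is immaterial. *)
Definition same_cycle (c d : seq pedge) : Prop := exists i, d = rot i c.

Definition strictly_linear : Prop :=
  forall c d, is_cycle c -> is_cycle d ->
  same_cycle c d \/ ~~ has (mem [seq pe_src e | e <- c]) [seq pe_src e | e <- d].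

Definition on_cycle (e : pedge) : Prop := exists2 c, is_cycle c & e \in c.
Definition recursive M : Prop :=
  exists2 c, is_cycle c & M \in [seq pe_src e | e <- c].

(** ** Executions *)

(* The node of a derived graph created as the copy of node [i] when a node [x]
   is replaced by means of production [k] is [rcons x (k, i)], and the initial
   node is [[::]]. Copies are thereby fresh, a node carries its whole history,
   and a derived graph determines its derivation up to the order in which
   distinct nodes are replaced. *)
Definition addr : choiceType := seq pedge.

Definition node_name M (x : addr) : Sigma := last M [seq pe_dst e | e <- x].

Record graph := Graph {
  gnodes : {fset addr};
  gedges : {fset addr * Gamma * addr} }.

Definition single : graph := Graph [fset ([::] : addr)] fset0.

Definition copy (x : addr) k (i : wnode (rhs k)) : addr :=
  rcons x (Tagged (fun k => wnode (rhs k)) i).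

(* [s] and [t] are meant to be the source and the sink of [rhs k]. *)
Definition replace (g : graph) (x : addr) k (s t : wnode (rhs k)) : graph :=
  Graph
    ((gnodes g `\ x) `|` [fset copy x i | i in wnode (rhs k)])
    ([fset (if e.1.1 == x then copy x t else e.1.1, e.1.2,
            if e.2 == x then copy x s else e.2) | e in gedges g]
     `|` [fset (copy x e.1.1, e.1.2, copy x e.2) | e in wedges (rhs k)]).

Inductive derives M : graph -> Prop :=
| derives_single : derives M single
| derives_replace g x k s t :
    derives M g -> x \in gnodes g -> node_name M x = lhs k ->
    @source_of k s -> @sink_of k t -> derives M (replace g x s t).

Definition execution M (g : graph) : Prop :=
  derives M g /\ forall x, x \in gnodes g -> node_name M x \notin composite G.

Definition run (g : graph) : Prop := execution (start G) g.

Definition is_input (g : graph) (x : addr) : Prop :=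
  x \in gnodes g /\ is_source (mem (gedges g)) x.
Definition is_output (g : graph) (x : addr) : Prop :=
  x \in gnodes g /\ is_sink (mem (gedges g)) x.
End Grammar.

(** * Regular path queries and safety *)

Inductive regex (Gamma : Type) :=
| REps
| RAny
| RSym of Gamma
| RCat of regex Gamma & regex Gamma
| RAlt of regex Gamma & regex Gamma
| RStar of regex Gamma
| RPlus of regex Gamma.

Fixpoint lang (Gamma : eqType) (R : regex Gamma) (w : seq Gamma) : Prop :=
  match R with
  | REps => w = [::]
  | RAny => size w = 1
  | RSym a => w = [:: a]
  | RCat R1 R2 => exists w1 w2, [/\ w = w1 ++ w2, lang R1 w1 & lang R2 w2]
  | RAlt R1 R2 => lang R1 w \/ lang R2 w
  | RStar R1 =>
      exists2 ws, w = flatten ws & forall x, x \in ws -> lang R1 x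
  | RPlus R1 =>
      exists ws, [/\ ws != [::], w = flatten ws & forall x, x \in ws -> lang R1 x]
  end.

Record dfa (Gamma : Type) := Dfa {
  state : finType;
  trans : state -> Gamma -> state;
  init : state;
  final : {set state} }.

Section Queries.
Variables (Sigma Gamma : finType) (G : grammar Sigma Gamma).

Definition query (R : regex Gamma) (g : graph G) (u v : addr G) : Prop :=
  exists2 p, is_path (mem (gedges g)) u p v & lang R (path_tags p).

Definition trans_star (A : dfa Gamma) : state A -> seq Gamma -> state A :=
  foldl (@trans _ A).

Definition dfa_accepts (A : dfa Gamma) (R : regex Gamma) : Prop :=
  forall w, trans_star (init A) w \in final A <-> lang R w.

Definition io_trans (A : dfa Gamma) (g : graph G) (q1 q2 : state A) : Prop :=
  exists x y p, [/\ is_input g x, is_output g y, is_path (mem (gedges g)) x p y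
                  & trans_star q1 (path_tags p) = q2].

Definition safe_dfa (A : dfa Gamma) : Prop :=
  forall (q1 q2 : state A) (M : Sigma) (ex1 ex2 : graph G),
  execution M ex1 -> execution M ex2 ->
  io_trans ex1 q1 q2 -> io_trans ex2 q1 q2.

Definition safe (R : regex Gamma) : Prop :=
  exists2 A, dfa_accepts A R & safe_dfa A.
End Queries.

(** * Labels *)

(* Ranks and all indices occurring in labels count from 0. *)
Record ordering (T : finType) := Ordering {
  rank :> T -> 'I_#|T|;
  rank_inj : injective rank }.

(* [cycles] lists every cycle once, starting at its chosen first edge. *)
Record numbering (Sigma Gamma : finType) (G : grammar Sigma Gamma) := Numbering {
  prod_order : ordering (production G);
  node_order : forall k : production G, ordering (wnode (rhs k));
  node_order_topological : forall k e,
    e \in wedges (rhs k) -> node_order k e.1.1 < node_order k e.2;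
  cycles : seq (seq (pedge G));
  cycles_sound : all (@is_cycle _ _ G) cycles;
  cycles_complete : forall c, is_cycle c ->
    exists! s, s < size cycles /\ same_cycle (nth [::] cycles s) c }.

(* [LProd k i] stands for (k, i) and [LRec s t j] for (s, t, j). *)
Variant tree_label := LProd of nat & nat | LRec of nat & nat & nat.

Section Labels.
Variables (Sigma Gamma : finType) (G : grammar Sigma Gamma).
Variables (N : numbering G) (g : graph G).

Definition pe_pair (e : pedge G) : tree_label :=
  LProd (prod_order N (tag e)) (node_order N (tag e) (tagged e)).

(* [e] is the edge reached from the [t]-th edge of the [s]-th cycle after [j]
   steps along the cycle. *)
Definition cycle_edge (s t j : nat) (e : pedge G) : Prop :=
  s < size (cycles N) /\
  let c := nth [::] (cycles N) s in
  t < size c /\ nth e c ((t + j) %% size c) = e.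

(* The vertices of the compressed parse tree: [TNode x] is the node [x] of the
   derivation, [TRec x] the recursive node put in the place of [x]. *)
Variant tree_vertex := TNode of addr G | TRec of addr G.

(* The nodes that occur in the derivation are the ancestors of nodes of [g]. *)
Definition occurs (x : addr G) : Prop := exists2 v, v \in gnodes g & prefix x v.

(* A node [x] with a recursive name continues an already started recursion
   exactly when it was created along a cycle edge. *)
Definition starts_recursion (x : addr G) : Prop :=
  recursive G (node_name (start G) x) /\
  forall y e, x = rcons y e -> ~ on_cycle e.

Inductive tree_edge : tree_vertex -> tree_label -> tree_vertex -> Prop :=
| edge_node x e :
    occurs (rcons x e) -> ~ recursive G (pe_dst e) ->
    tree_edge (TNode x) (pe_pair e) (TNode (rcons x e))
| edge_rec x e :
    occurs (rcons x e) -> starts_recursion (rcons x e) ->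
    tree_edge (TNode x) (pe_pair e) (TRec (rcons x e))
| edge_first x s t e :
    occurs x -> starts_recursion x ->
    cycle_edge s t 0 e -> pe_src e = node_name (start G) x ->
    tree_edge (TRec x) (LRec s t 0) (TNode x)
| edge_next x s t j y e :
    tree_edge (TRec x) (LRec s t j) (TNode y) ->
    occurs (rcons y e) -> cycle_edge s t j e ->
    tree_edge (TRec x) (LRec s t j.+1) (TNode (rcons y e)).

Definition tree_root (r : tree_vertex) : Prop :=
  (starts_recursion [::] /\ r = TRec [::]) \/
  (~ starts_recursion [::] /\ r = TNode [::]).

Inductive tree_path : tree_vertex -> seq tree_label -> tree_vertex -> Prop :=
| tree_path_nil a : tree_path a [::] a
| tree_path_cons a l b ls c :
    tree_edge a l b -> tree_path b ls c -> tree_path a (l :: ls) c.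

Definition psi (v : addr G) (ls : seq tree_label) : Prop :=
  exists2 r, tree_root r & tree_path r ls (TNode v).
End Labels.

(** * Word RAM *)

(* The memory consists of 2 ^ w words of w bits: addresses and stored values are
   taken modulo 2 ^ w. Every instruction takes one unit of time. *)
Variant word_op :=
  OAdd | OSub | OMul | ODiv | OMod | OAnd | OOr | OXor | OShl | OShr | OEq | OLt.

Variant instr :=
| IConst of nat & nat                (* M[d] := c *)
| IOp of word_op & nat & nat & nat   (* M[d] := M[a] op M[b] *)
| ILoad of nat & nat                 (* M[d] := M[M[a]] *)
| IStore of nat & nat                (* M[M[a]] := M[b] *)
| IJumpZero of nat & nat             (* if M[a] = 0 then goto l *)
| IHalt of nat.                      (* stop with answer M[a] <> 0 *)

Section WordRAM.
Variable w : nat.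

Definition memory := nat -> nat.

Definition eval_op (o : word_op) (x y : nat) : nat :=
  match o with
  | OAdd => x + y
  | OSub => x + (2 ^ w - y)
  | OMul => x * y
  | ODiv => x %/ y
  | OMod => x %% y
  | OAnd => Nat.land x y
  | OOr => Nat.lor x y
  | OXor => Nat.lxor x y
  | OShl => x * 2 ^ y
  | OShr => x %/ 2 ^ y
  | OEq => x == y
  | OLt => x < y
  end.

Definition read (m : memory) (a : nat) : nat := m (a %% 2 ^ w).
Definition write (m : memory) (a x : nat) : memory :=
  fun b => if b == a %% 2 ^ w then x %% 2 ^ w else m b.

Fixpoint exec (prog : seq instr) (time pc : nat) (m : memory) : option bool :=
  if time is time'.+1 then
    match onth prog pc with
    | None => None
    | Some (IConst d c) => exec prog time' pc.+1 (write m d c)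
    | Some (IOp o d a b) =>
        exec prog time' pc.+1 (write m d (eval_op o (read m a) (read m b)))
    | Some (ILoad d a) => exec prog time' pc.+1 (write m d (read m (read m a)))
    | Some (IStore a b) => exec prog time' pc.+1 (write m (read m a) (read m b))
    | Some (IJumpZero a l) =>
        exec prog time' (if read m a == 0 then l else pc.+1) m
    | Some (IHalt a) => Some (read m a != 0)
    end
  else None.

(* An integer of w bits is stored as it is. The integers of a label have at most
   log n + O(1) bits, except for the indices along a cycle all of whose
   productions have a single node on their right-hand side: such a recursion can
   be unfolded arbitrarily often without increasing the run. *)
Definition load_input (input : seq nat) : memory :=
  fun a => nth 0 input a %% 2 ^ w.

(* [prog], started on [input], halts within [time] steps with answer [b]. *)
Definition computes (prog : seq instr) (time : nat) (input : seq nat) (b : bool) :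
  Prop := exec prog time 0 (load_input input) = Some b.
End WordRAM.

Definition encode_tree_label (l : tree_label) : seq nat :=
  match l with
  | LProd k i => [:: 0; k; i; 0]
  | LRec s t j => [:: 1; s; t; j]
  end.

Definition encode_label (ls : seq tree_label) : seq nat :=
  size ls :: flatten [seq encode_tree_label l | l <- ls].

(* Main.v *)
(* Address the nodes of a run by the sequence of production-graph edges that
   created them.  A path from [u = p ++ e :: a] to [v = p ++ f :: b] leaves the
   subtrees around [u] one after the other through their outputs, crosses one
   right-hand side from [e] to [f], and enters the subtrees around [v] through
   their inputs.  By safety the state changes realised by an execution that is
   crossed from input to output depend on its module only, so the answer is read
   off the products, along [a] and [b], of relations on the states of the DFA
   that depend on single letters.  A label spells the address of its node, where
   [LRec s t j] stands for [j] steps along a cycle; since the products range over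
   a finite set, they are ultimately periodic in [j].  Hence the answer depends
   only on the boundedly many values, up to a bounded threshold and modulo a
   fixed period, of the differences of entries of the two labels, and a decision
   tree over word comparisons, subtractions and remainders computes it. *)

Require Import Defs.
From HB Require Import structures.
From mathcomp Require Import all_boot.
From mathcomp Require Import finmap.
From mathcomp Require Import boolp zify.

Set Implicit Arguments.
Unset Strict Implicit.
Unset Printing Implicit Defensive.

(** * Derived graphs *)

(** Two obstacles shape the proof. First, one program must serve all runs and all word sizes. The
    answer is therefore shown to depend only on the outcomes of a fixed list of tests, even between
    runs with different word sizes, and the program tabulates it; the table is chosen classically.
    The threshold [K] exceeds the label length and bounds all entries except recursion indices, as
    well as the preperiods of iterations on pairs (letter, summary). The period [P] is a multiple of
    their periods and of all cycle lengths, hence a factorial. Second, a recursion index may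
    overflow a word. A cycle with a branching production adds nodes on every turn, so its indices
    fit. On any other cycle the letters act as identities once a first letter is recorded, and two
    indices below one recursive node coincide, since leaving the cycle at different depths takes two
    nodes in one right-hand side. Labels have bounded length because the letters off the cycles have
    distinct sources and recursive entries are never adjacent. Strict linearity makes two labels
    through one recursive node unfold the same cycle from the same edge. *)

Section Frontier.
Variables (Sigma Gamma : finType) (G : grammar Sigma Gamma).
Hypothesis G_coarse : coarse_grained G.
Implicit Types (e f h : pedge G) (x y p a b : addr G) (g : graph G) (M : Sigma).

Local Notation pe := (Tagged (fun k => wnode (rhs k))).

(** Edges of right-hand sides are phrased on address letters, so that no equation between dependent
    node types has to be stated. *)
Definition wedge e (t : Gamma) f : Prop :=
  exists k (w : wnode (rhs k) * Gamma * wnode (rhs k)),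
  [/\ w \in wedges (rhs k), e = pe w.1.1,
      t = w.1.2 & f = pe w.2].

Definition src e : bool := `[< source_of (tagged e) >].
Definition snk e : bool := `[< sink_of (tagged e) >].

Lemma wedge_tag e t f : wedge e t f -> tag e = tag f.
Proof. by case=> k [w [_ -> _ ->]]. Qed.

Lemma wedge_snkF e t f : wedge e t f -> snk e = false.
Proof.
case=> k [w [wW -> _ _]]; apply/asboolP => /(_ w wW) /=.
by rewrite eqxx.
Qed.

Lemma wedge_srcF e t f : wedge e t f -> src f = false.
Proof.
case=> k [w [wW _ _ ->]]; apply/asboolP => /(_ w wW) /=.
by rewrite eqxx.
Qed.

Lemma srcPn f : ~~ src f -> exists e t, wedge e t f.
Proof.
case: f => k i /asboolPn /existsNP [w /not_implyP [wW /negP/negPn/eqP wi]].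
by exists (pe w.1.1), w.1.2, k, w; split; rewrite // wi.
Qed.

Lemma snkPn e : ~~ snk e -> exists t f, wedge e t f.
Proof.
case: e => k i /asboolPn /existsNP [w /not_implyP [wW /negP/negPn/eqP wi]].
by exists w.1.2, (pe w.2), k, w; split; rewrite // wi.
Qed.

Lemma src_inj e f : src e -> src f -> tag e = tag f -> e = f.
Proof.
case: e f => k i [k' j] /asboolP/= si /asboolP/= sj kk'.
case: k' / kk' j sj => j sj; have [[s [_ us]] _] := G_coarse k.
by rewrite -(us i si) -(us j sj).
Qed.

Lemma snk_inj e f : snk e -> snk f -> tag e = tag f -> e = f.
Proof.
case: e f => k i [k' j] /asboolP/= si /asboolP/= sj kk'.
case: k' / kk' j sj => j sj; have [_ [s [_ us]]] := G_coarse k.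
by rewrite -(us i si) -(us j sj).
Qed.

Lemma src_exists (k : production G) : exists2 e, src e & tag e = k.
Proof.
have [[s [ss _]] _] := G_coarse k.
by exists (pe s) => //; apply/asboolP.
Qed.

Lemma snk_exists (k : production G) : exists2 e, snk e & tag e = k.
Proof.
have [_ [s [ss _]]] := G_coarse k.
by exists (pe s) => //; apply/asboolP.
Qed.

(** [x] has appeared in the derivation of [g]; it may have been replaced since. *)
Definition occ g x : Prop := exists b, x ++ b \in gnodes g.

Lemma occ_cat g x b : occ g (x ++ b) -> occ g x.
Proof. by case=> c; rewrite -catA; exists (b ++ c). Qed.

Lemma in_replace g x (k : production G) (s t : wnode (rhs k)) a :
  (a \in gnodes (replace g x s t)) =
  (a \in gnodes g) && (a != x) ||
  [exists i : wnode (rhs k), a == rcons x (pe i)].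
Proof.
rewrite /replace /= inE in_fsetD1 andbC; congr orb.
apply/imfsetP/existsP => [[i _ ->]|[i /eqP ->]]; first by exists i; rewrite /copy.
by exists i.
Qed.

Lemma in_replaceP g x (k : production G) (s t : wnode (rhs k)) a :
  a \in gnodes (replace g x s t) <->
  (a \in gnodes g /\ a <> x) \/ exists2 e, tag e = k & a = rcons x e.
Proof.
rewrite in_replace; split.
  case/orP=> [/andP[-> /eqP ax]|/existsP[i /eqP ->]]; first by left.
  by right; exists (pe i).
case=> [[-> /eqP ->//]|[[k' i] /= kk' ->]].
by case: k / kk' s t => s t; rewrite orbC; apply/orP; left; apply/existsP; exists i.
Qed.

Lemma cat_eq_rcons (p a x : seq (pedge G)) e f : p ++ e :: a = rcons x f ->
  (p = x /\ e = f /\ a = [::]) \/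
  (exists a', a = rcons a' f /\ x = p ++ e :: a').
Proof.
case/lastP: a => [|a' f'].
  by rewrite cats1 => /rcons_inj[-> ->]; left.
rewrite -rcons_cons -rcons_cat => /rcons_inj[<- <-].
by right; exists a'.
Qed.

(** A replaced node disappears, so no node of [g] is a proper ancestor of another. *)
Lemma antichain M g : derives M g -> forall a b,
  a \in gnodes g -> a ++ b \in gnodes g -> b = [::].
Proof.
elim=> {g} [a b|g x k s t dg IH xg xk ss st a b].
  by rewrite !inE => /eqP-> /eqP.
move=> /in_replaceP[[ag ax]|[e ek ->]] /in_replaceP[[bg bx]|[f fk eqf]].
- exact: IH ag bg.
- case/lastP: b eqf => [//|b f']; rewrite -rcons_cat => /rcons_inj[eqx _].
  by have := IH a b ag; rewrite eqx => /(_ xg) b0; move: eqx ax; rewrite b0 cats0.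
- by move: bg; rewrite cat_rcons => /(IH _ _ xg).
- by move/(congr1 size): eqf; rewrite size_cat !size_rcons -[RHS]addn0 => /addnI/size0nil.
Qed.

(** An address is replaced at most once, so everything strictly below [p] stems from a single
    production. *)
Lemma consistent M g : derives M g -> forall p e f a b,
  p ++ e :: a \in gnodes g -> p ++ f :: b \in gnodes g -> tag e = tag f.
Proof.
elim=> {g} [p e f a b|g x k s t dg IH xg xk ss st p e f a b].
  by rewrite !inE; case: p.
have ac := antichain dg.
move=> /in_replaceP[[ag ax]|[e' ek eqe]] /in_replaceP[[bg bx]|[f' fk eqf]].
- exact: IH ag bg.
- case: (cat_eq_rcons eqf) => [[px _]|[b' [_ xE]]].
    by move: ag; rewrite px => /(ac _ _ xg).
  by move: xg; rewrite xE; apply: IH ag.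
- case: (cat_eq_rcons eqe) => [[px _]|[b' [_ xE]]].
    by move: bg; rewrite px => /(ac _ _ xg).
  by move: xg; rewrite xE => xg; apply: IH xg bg.
case: (cat_eq_rcons eqe) => [[px [-> _]]|[a' [_ xE]]];
case: (cat_eq_rcons eqf) => [[px' [-> _]]|[b' [_ xE']]].
- by rewrite ek.
- by move/(congr1 size): xE'; rewrite -px size_cat /= -[LHS]addn0 => /addnI.
- by move/(congr1 size): xE; rewrite -px' size_cat /= -[LHS]addn0 => /addnI.
- by move/eqP: xE'; rewrite xE eqseq_cat // eqxx /= eqseq_cons => /andP[/eqP->].
Qed.

Lemma occ_replace g x (k : production G) (s t : wnode (rhs k)) y :
  occ g y -> occ (replace g x s t) y.
Proof.
case=> b yb; case: (eqVneq (y ++ b) x) => [<-|/eqP neq].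
  (* The right-hand side has at least the node [s], so something remains below a replaced
     address. *)
  exists (rcons b (pe s)); apply/in_replaceP; right.
  by exists (pe s); rewrite // rcons_cat.
by exists b; apply/in_replaceP; left.
Qed.

Lemma occ_sibling M g : derives M g -> forall p e f,
  occ g (rcons p e) -> tag e = tag f -> occ g (rcons p f).
Proof.
elim=> {g} [p e f [b]|g x k s t dg IH xg xk ss st p e f].
  by rewrite cat_rcons inE; case: p.
case=> b; rewrite cat_rcons => /in_replaceP[[ag ax]|[e' ek eqe]] ef.
  by apply/occ_replace/(IH p e) => //; exists b; rewrite cat_rcons.
case: (cat_eq_rcons eqe) => [[px [ee' _]]|[a' [_ xE]]].
  exists [::]; rewrite cats0; apply/in_replaceP; right; exists f; last by rewrite px.
  by rewrite -ef ee'.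
by apply/occ_replace/(IH p e) => //; exists a'; rewrite cat_rcons -xE.
Qed.

Lemma occ_name M g : derives M g -> forall p e,
  occ g (rcons p e) -> pe_src e = node_name M p.
Proof.
elim=> {g} [p e [b]|g x k s t dg IH xg xk ss st p e].
  by rewrite cat_rcons inE; case: p.
case=> b; rewrite cat_rcons => /in_replaceP[[ag ax]|[e' ek eqe]].
  by apply: IH; exists b; rewrite cat_rcons.
case: (cat_eq_rcons eqe) => [[-> [-> _]]|[a' [_ xE]]].
  by rewrite xk /pe_src ek.
by apply: IH; exists a'; rewrite cat_rcons -xE.
Qed.

(** Redirection sends edges to the source of the source and so on. Hence [P := src] describes the
    input of the part of [g] below [x], and [P := snk] its output. *)
Definition ext (P : pred (pedge G)) g x a :=
  a \in gnodes g /\ exists2 b, a = x ++ b & all P b.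
Notation isin := (ext src).
Notation isout := (ext snk).

Lemma ext_exists (P : pred (pedge G)) M g : derives M g ->
  (forall k, exists2 e, P e & tag e = k) ->
  forall x, occ g x -> exists a, ext P g x a.
Proof.
move=> dg Pex; elim: dg => {g} [x [b]|g x k s t dg IH xg xk ss st y].
  by rewrite inE; case: x => // _; exists [::]; split; [rewrite inE|exists [::]].
have old z : occ g z -> exists a, ext P (replace g x s t) z a.
  case/IH=> a [ag [b aE sb]]; case: (eqVneq a x) => [ax|/eqP neq].
    have [e Pe ek] := Pex k; exists (rcons a e); split.
      by apply/in_replaceP; right; exists e; rewrite // ax.
    by exists (rcons b e); rewrite ?aE ?rcons_cat // all_rcons Pe.
  by exists a; split; [apply/in_replaceP; left|exists b].
case=> b => /in_replaceP[[bg _]|[e' ek eqe]]; first by apply: old; exists b.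
case/lastP: b eqe => [|b f]; last first.
  by rewrite -rcons_cat => /rcons_inj[yE _]; apply: old; exists b; rewrite yE.
rewrite cats0 => ->; exists (rcons x e'); split; last by exists [::]; rewrite ?cats0.
by apply/in_replaceP; right; exists e'.
Qed.

Lemma isin_exists M g x : derives M g -> occ g x -> exists a, isin g x a.
Proof. by move=> dg; apply: ext_exists dg src_exists _. Qed.

Lemma isout_exists M g x : derives M g -> occ g x -> exists a, isout g x a.
Proof. by move=> dg; apply: ext_exists dg snk_exists _. Qed.

Lemma ext_inj (P : pred (pedge G)) M g : derives M g ->
  (forall e f, P e -> P f -> tag e = tag f -> e = f) ->
  forall x a b, ext P g x a -> ext P g x b -> a = b.
Proof.
move=> dg Pinj x a a' [ag [b aE Pb]] [a'g [c a'E Pc]]; rewrite {}aE {}a'E in ag a'g *.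
congr (_ ++ _); elim: b x c ag a'g Pb Pc => [|e b IH] x [|f c] // xb xc.
- by rewrite cats0 in xb; have := antichain dg xb xc.
- by rewrite cats0 in xc; have := antichain dg xc xb.
move=> /= /andP[Pe Pb] /andP[Pf Pc].
have ef : e = f by apply: Pinj => //; apply: consistent dg _ _ _ _ _ xb xc.
by rewrite -ef in xc *; congr cons; apply: (IH (rcons x e)); rewrite ?cat_rcons.
Qed.

Lemma isin_inj M g x a b : derives M g -> isin g x a -> isin g x b -> a = b.
Proof. by move=> dg; apply: ext_inj dg src_inj _ _ _. Qed.

Lemma isout_inj M g x a b : derives M g -> isout g x a -> isout g x b -> a = b.
Proof. by move=> dg; apply: ext_inj dg snk_inj _ _ _. Qed.

Lemma ext_occ (P : pred (pedge G)) g x a : ext P g x a -> occ g x.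
Proof. by case=> ag [b aE _]; exists b; rewrite -aE. Qed.

(** An edge is born between siblings [e] and [f] below [p]. Later replacements only push its origin
    down along sinks and its target down along sources. This describes the edges from the nodes
    alone, without reference to the order of replacements. *)
Definition edge_spec a (t : Gamma) b := exists p e f a' b',
  [/\ wedge e t f, a = p ++ e :: a', b = p ++ f :: b', all snk a' & all src b'].

Lemma diverge (p q a b a' b' : seq (pedge G)) e f e' f' :
  p ++ e :: a = q ++ e' :: a' -> p ++ f :: b = q ++ f' :: b' ->
  e != f -> e' != f' -> [/\ p = q, e = e', f = f', a = a' & b = b'].
Proof.
elim: p q => [|h p IH] [|h' q] /=.
- by move=> [-> ->] [-> ->].
- by move=> [-> _] [-> _]; rewrite eqxx.
- by move=> [<- _] [<- _] _; rewrite eqxx.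
by move=> [<- ae] [be] ef ef'; have [-> -> -> -> ->] := IH _ ae be ef ef'.
Qed.

Lemma wedge_neq e t f : wedge e t f -> e != f.
Proof.
case=> k [w [wW -> _ ->]]; apply/eqP => /eqP; rewrite eq_Tagged /= => /eqP w12.
have : is_path (mem (wedges (rhs k))) w.1.1 [:: w] w.1.1.
  by rewrite /= w12 !eqxx !andbT.
by move/wacyclic.
Qed.

Lemma edge_specP M g : derives M g -> forall a t b,
  (a, t, b) \in gedges g <->
  [/\ a \in gnodes g, b \in gnodes g & edge_spec a t b].
Proof.
elim=> {g} [a u b|g x k s t dg IH xg xk ss st a u b].
  split; first by rewrite inE.
  by case; rewrite !inE => /eqP-> _ [p [e [f [a' [b' [_]]]]]]; case: p.
have ac := antichain dg.
rewrite [gedges _]/= in_fsetU; split.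
  case/orP => /imfsetP[].
    move=> [[a' u'] b'] /= E0.
    have [ag bg [p [e [f [a1 [b1 [W aE bE sa sb]]]]]]] := (IH _ _ _).1 E0; move=> [-> -> ->].
    split.
    - apply/(in_replaceP g x s t); case: (eqVneq a' x) => [_|/eqP]; last by left.
      by right; exists (pe t).
    - apply/(in_replaceP g x s t); case: (eqVneq b' x) => [_|/eqP]; last by left.
      by right; exists (pe s).
    exists p, e, f, (if a' == x then rcons a1 (pe t) else a1),
       (if b' == x then rcons b1 (pe s) else b1); split=> //.
    - by case: eqP => [<-|//]; rewrite aE /copy rcons_cat.
    - by case: eqP => [<-|//]; rewrite bE /copy rcons_cat.
    - by case: ifP => // _; rewrite all_rcons sa andbT; apply/asboolP.
    - by case: ifP => // _; rewrite all_rcons sb andbT; apply/asboolP.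
  case=> [[i u'] j] /= W [-> -> ->]; split.
  - by apply/(in_replaceP g x s t); right; exists (pe i).
  - by apply/(in_replaceP g x s t); right; exists (pe j).
  exists x, (pe i), (pe j), [::], [::]; split=> //; rewrite /copy ?cats1 //.
  by exists k, (i, u', j); split.
case=> ag bg [p [e [f [a' [b' [W aE bE sa sb]]]]]]; apply/orP.
(* Undoes the last replacement at one endpoint: either its sibling letter was created just now, or
   the endpoint comes from a node of [g], possibly [x] itself. *)
have back (c c' : seq (pedge G)) h (P : pred (pedge G)) (r : wnode (rhs k)) :
    all P c' -> c = p ++ h :: c' -> c \in gnodes (replace g x s t) -> 
    P (pe r) -> (forall h' h'', P h' -> P h'' -> tag h' = tag h'' -> h' = h'') ->
    (p == x /\ tag h = k /\ c' = [::]) \/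
    exists c1, [/\ all P c1, p ++ h :: c1 \in gnodes g &
      c = if p ++ h :: c1 == x then rcons x (pe r) else p ++ h :: c1].
  move=> Pc' cE /in_replaceP cg Pr Pinj; case: cg => [[cg cx]|[h' hk eqc]].
    by right; exists c'; rewrite -cE; split=> //; case: eqP cx.
  case: (cat_eq_rcons (etrans (esym cE) eqc)) => [[-> [-> ->]]|[c1 [c1E xE]]].
    by left.
  right; exists c1; move: Pc'; rewrite c1E all_rcons => /andP[Ph' Pc1].
  by split; rewrite -?xE ?eqxx // eqc; congr rcons; apply: Pinj; rewrite ?hk.
have sk : snk (pe t) by apply/asboolP.
have sr : src (pe s) by apply/asboolP.
have [[/eqP px [ek a0]]|[a1 [sa1 a1g a1E]]] := back _ _ _ _ _ sa aE ag sk snk_inj.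
  have [[_ [fk b0]]|[b1 [_ b1g _]]] := back _ _ _ _ _ sb bE bg sr src_inj; last first.
    by move: b1g; rewrite px => /(ac _ _ xg).
  right; move: W => [k' [w [wW eE uE fE]]].
  rewrite aE bE a0 b0 uE px eE fE in ek *; move: ek => /= kk'.
  case: k / kk' s t {eE fE fk xk ss st ag bg back sk sr} => s t.
  by apply/imfsetP; exists w; rewrite //= /copy !cats1.
have [[/eqP px [ek b0]]|[b1 [sb1 b1g b1E]]] := back _ _ _ _ _ sb bE bg sr src_inj.
  by move: a1g; rewrite px => /(ac _ _ xg).
left; apply/imfsetP; exists (p ++ e :: a1, u, p ++ f :: b1) => /=.
  by apply/IH; split=> //; exists p, e, f, a1, b1; split.
by rewrite a1E b1E /copy; congr (_, _, _); case: eqP => // ->.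
Qed.

End Frontier.

(** * Paths in runs *)

Section Reachability.
Variables (Sigma Gamma : finType) (G : grammar Sigma Gamma).
Variables (N : numbering G) (A : dfa Gamma).
Hypotheses (G_coarse : coarse_grained G) (A_safe : safe_dfa G A).
Notation isin := (ext (@src _ _ G)).
Notation isout := (ext (@snk _ _ G)).
Implicit Types (e f h : pedge G) (x y p a b : addr G) (g : graph G) (M : Sigma).
Implicit Types (q : state A).

Definition pe_rank e : nat := node_order N (tag e) (tagged e).

Lemma wedge_rank e t f : wedge e t f -> pe_rank e < pe_rank f.
Proof. by case=> k [w [wW -> _ ->]]; apply: node_order_topological. Qed.

(* Edges increase the lexicographic order, and the addresses below a given one
   are convex for it: a path cannot leave a subtree and return to it. *)
Fixpoint lexlt (a b : seq (pedge G)) : bool :=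
  match a, b with
  | e :: a', f :: b' => (pe_rank e < pe_rank f) || (e == f) && lexlt a' b'
  | _, _ => false
  end.

Lemma lexlt_irr a : lexlt a a = false.
Proof. by elim: a => //= e a ->; rewrite ltnn andbF. Qed.

Lemma lexlt_trans : transitive lexlt.
Proof.
move=> b a c; elim: b a c => [|f b IH] [|e a] [|h c] //=.
case/orP=> [ef|/andP[/eqP-> ab]] /orP[fh|/andP[/eqP<- bc]].
- by rewrite (ltn_trans ef fh).
- by rewrite ef.
- by rewrite fh.
by rewrite eqxx (IH _ _ ab bc) orbT.
Qed.

Lemma lexlt_cat p a b : lexlt (p ++ a) (p ++ b) = lexlt a b.
Proof. by elim: p => //= e p ->; rewrite ltnn eqxx. Qed.

Lemma lexlt_convex p a b (c : seq (pedge G)) : lexlt (p ++ a) c -> lexlt c (p ++ b) ->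
  exists d, c = p ++ d.
Proof.
elim: p c => [c _ _|e p IH [|f c]] //=; first by exists c.
case/orP=> [ef|/andP[/eqP<- ac]] /orP[fe|/andP[/eqP fe cb]].
- by have := ltn_trans ef fe; rewrite ltnn.
- by move: ef; rewrite fe ltnn.
- by move: fe; rewrite ltnn.
by have [d ->] := IH _ ac cb; exists d.
Qed.

Inductive reach g : addr G -> addr G -> state A -> state A -> Prop :=
| reach_nil a q : reach g a a q q
| reach_cons a t b c q q' : (a, t, b) \in gedges g ->
    reach g b c (trans q t) q' -> reach g a c q q'.

Lemma reachP g a b q q' : reach g a b q q' <->
  exists2 p, is_path (mem (gedges g)) a p b & trans_star q (path_tags p) = q'.
Proof.
split; first elim=> {a b q q'} [a q|a t b c q q' ab _ [p bp <-]].
- by exists [::] => //=.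
- by exists ((a, t, b) :: p) => //=; rewrite eqxx bp ab.
case=> p; elim: p a q => [|[[a' t] c] p IH] a q /=.
  by move=> /eqP<- <-; constructor.
by case/and3P=> ac /eqP<- cp /(IH _ _ cp); apply: reach_cons ac.
Qed.

Lemma reach_trans g a b c q q1 q2 : reach g a b q q1 -> reach g b c q1 q2 ->
  reach g a c q q2.
Proof. by elim=> // {}a t d {}b {}q {}q1 ad _ IH /IH; apply: reach_cons ad. Qed.

(** The replacements below [x] form a derivation of their own, which is what lets safety act inside
    a run. Only node sets are compared, because [edge_specP] recovers the edges from them. *)
Lemma subderivation M g x : derives M g -> occ g x -> exists2 g', derives (node_name M x) g' &
  forall a, a \in gnodes g' = (x ++ a \in gnodes g).
Proof.
move=> dg; elim: dg x => {g} [x [b]|g x k s t dg IH xg xk ss st y yo].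
  rewrite inE; case: x => //; exists (single _); first by constructor.
  by [].
have ac := antichain dg.
have [yg|nyg] := pselect (occ g y); last first.
  case: yo => b /in_replaceP[[yb _]|[e ek]]; first by case: nyg; exists b.
  case/lastP: b => [|b f]; last first.
    by rewrite -rcons_cat => /rcons_inj[yE _]; case: nyg; exists b; rewrite yE.
  rewrite cats0 => yE; exists (single _); first by constructor.
  move=> a; rewrite inE; apply/eqP/idP => [->|].
    by apply/in_replaceP; right; exists e; rewrite ?cats0.
  case/in_replaceP=> [[ya _]|[f fk]]; first by case: nyg; exists a.
  by rewrite yE => /(congr1 size); rewrite size_cat !size_rcons -[RHS]addn0 => /addnI/size0nil.
have [g' dg' g'E] := IH y yg.
have [/prefixP[a xE]|yx] := boolP (prefix y x).
  exists (replace g' a s t).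
    constructor=> //; first by rewrite g'E -xE.
    by rewrite -xk xE /node_name map_cat last_cat.
  move=> b; apply/idP/idP => /in_replaceP[[bg bx]|[e ek bE]]; apply/in_replaceP.
  - left; rewrite -g'E; split=> //; rewrite xE => /eqP.
    by rewrite eqseq_cat // eqxx => /eqP.
  - by right; exists e; rewrite // bE xE rcons_cat.
  - left; rewrite g'E; split=> // ba; apply: bx.
    by rewrite ba xE.
  - right; exists e => //; apply/eqP; move/eqP: bE.
    by rewrite xE rcons_cat eqseq_cat // eqxx.
exists g' => // b; rewrite g'E; apply/idP/idP.
  move=> bg; apply/in_replaceP; left; split=> // bx.
  by rewrite -bx prefix_prefix in yx.
case/in_replaceP=> [[]//|[e ek]].
case/lastP: b => [|b f]; last first.
  by rewrite -rcons_cat => /rcons_inj[xE _]; rewrite -xE prefix_prefix in yx.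
rewrite cats0 => yE; case: yg => b; rewrite yE cat_rcons => /(ac _ _ xg).
by [].
Qed.

Lemma prefix_diverge (x p a b c d : seq (pedge G)) e f : e != f ->
  x ++ a = p ++ e :: c -> x ++ b = p ++ f :: d -> exists p', p = x ++ p'.
Proof.
move=> ef; elim: x p => [|h x IH] [|h' p] /=; try by eexists.
  by move=> [-> _] [fh _]; rewrite fh eqxx in ef.
by move=> [-> aE] [bE]; have [p' ->] := IH _ aE bE; exists p'.
Qed.

Lemma reach_inv g a b q q' : reach g a b q q' -> (a = b /\ q = q') \/
  exists t c, (a, t, c) \in gedges g /\ reach g c b (trans q t) q'.
Proof. by case=> [c r|c t d e r r' cd de]; [left|right; exists t, d]. Qed.

(** * Leaving and entering subtrees of the derivation *)

Section Derived.
Variables (M : Sigma) (g : graph G).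
Hypothesis dg : derives M g.

Lemma edgeP a t b : (a, t, b) \in gedges g <->
  [/\ a \in gnodes g, b \in gnodes g & edge_spec a t b].
Proof. exact: (edge_specP G_coarse dg). Qed.

Lemma edge_lexlt a t b : (a, t, b) \in gedges g -> lexlt a b.
Proof.
case/edgeP=> _ _ [p [e [f [a' [b' [/wedge_rank W -> -> _ _]]]]]].
by rewrite lexlt_cat /= W.
Qed.

Lemma reach_lexle a b q q' : reach g a b q q' -> (a = b /\ q = q') \/ lexlt a b.
Proof.
elim=> {a b q q'} [|a t b c q q' /edge_lexlt ab _ [[<- _]|bc]]; [by left|by right|right].
exact: lexlt_trans bc.
Qed.

Lemma reach_same a q q' : reach g a a q q' -> q = q'.
Proof. by case/reach_lexle=> [[]//|]; rewrite lexlt_irr. Qed.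

Lemma reach_convex p a t b c q q' : (p ++ a, t, b) \in gedges g ->
  reach g b (p ++ c) q q' -> exists d, b = p ++ d.
Proof.
move=> /edge_lexlt ab /reach_lexle[[-> _]|]; [by exists c|exact: lexlt_convex ab].
Qed.

(* A path leaves or enters the part of the graph below [x] through the edges of
   a right-hand side strictly above [x]. *)
Lemma edge_leave x a t b : (x ++ a, t, b) \in gedges g ->
  ~~ prefix x b -> isout g x (x ++ a).
Proof.
case/edgeP=> ag bg [p [e [f [a' [b' [W aE bE sa sb]]]]]] xb; split=> //.
exists a => //; move: bE aE xb => -> {b bg}.
elim: x p a {ag} => [|h x IH] [|h' p] a //=.
  by move=> [_ aE] _; move: sa; rewrite -aE all_cat => /andP[].
by move=> [<- aE]; rewrite eqxx => /= xb; apply: IH aE xb.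
Qed.

Lemma edge_enter x a t b : (a, t, x ++ b) \in gedges g ->
  ~~ prefix x a -> isin g x (x ++ b).
Proof.
case/edgeP=> ag bg [p [e [f [a' [b' [W aE bE sa sb]]]]]] xb; split=> //.
exists b => //; move: aE bE xb => -> {a ag}.
elim: x p b {bg} => [|h x IH] [|h' p] b //=.
  by move=> [_ bE] _; move: sb; rewrite -bE all_cat => /andP[].
by move=> [<- aE]; rewrite eqxx => /= xb; apply: IH aE xb.
Qed.

(** The path is cut at its first edge out of the subtree, whose origin must be the output of the
    subtree. *)
Lemma reach_leave x a b q q' : reach g (x ++ a) b q q' -> ~~ prefix x b ->
  exists o q1, [/\ isout g x o, reach g (x ++ a) o q q1 & reach g o b q1 q'].
Proof.
move cE: (x ++ a) => c cb; elim: cb a cE => {c b q q'} [c q a <-|c t d b q q' cd db IH a cE] xb.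
  by rewrite prefix_prefix in xb.
have [/prefixP[d' dE]|xd] := boolP (prefix x d); last first.
  exists c, q; split; [|exact: reach_nil|exact: reach_cons db].
  by rewrite -cE in cd *; apply: edge_leave cd xd.
have [o [q1 [xo do_ ob]]] := IH d' (esym dE) xb.
by exists o, q1; split=> //; apply: reach_cons do_.
Qed.

Lemma reach_enter x a b q q' : reach g a (x ++ b) q q' -> ~~ prefix x a ->
  exists i q1, [/\ isin g x i, reach g a i q q1 & reach g i (x ++ b) q1 q'].
Proof.
move cE: (x ++ b) => c ac'; elim: ac' b cE => {a c q q'} [c q b <-|a t d c q q' ad dc IH b cE] xa.
  by rewrite prefix_prefix in xa.
have [/prefixP[d' dE]|xd] := boolP (prefix x d).
  exists d, (trans q t); split=> //; last exact: reach_cons ad (reach_nil _ _ _).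
  by rewrite dE in ad *; apply: edge_enter ad xa.
have [i [q1 [xi di ib]]] := IH b cE xd.
by exists i, q1; split=> //; apply: reach_cons di.
Qed.

Lemma prefix_rcons_disjoint p e f (a : seq (pedge G)) :
  e != f -> prefix (rcons p e) (rcons p f ++ a) = false.
Proof. by move=> /negbTE ef; elim: p => [|h p IH] /=; rewrite ?ef // eqxx IH. Qed.

Lemma not_allP (P : pred (pedge G)) a : ~~ all P a ->
  exists p f b, [/\ a = p ++ f :: b, ~~ P f & all P b].
Proof.
elim: a => //= e a IH; have [Pa|/IH [p [f [b [-> ? ?]]]] _] := boolP (all P a).
  by rewrite andbT => Pe; exists [::], e, a.
by exists (e :: p), f, b.
Qed.

Lemma is_inputP a : is_input g a <-> isin g [::] a.
Proof.
split=> [[ag asrc]|[ag [a1 /= a1E sa]]]; split=> //; last first.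
  rewrite -a1E in sa.
  move=> [[c t] b] /edgeP[_ _ [p [e [f [a' [b' [/wedge_srcF W _ bE _ _]]]]]]].
  by apply/eqP => /= ba; move: sa; rewrite -ba bE all_cat /= W andbF.
(* [f] is the lowest letter of [a] that is not a source; an edge into [f] in its right-hand side
   survives as an edge into [a]. *)
exists a => //; apply: contraT => /not_allP[p [f [b [aE /srcPn[e [t W]] sb]]]].
have po : occ g (rcons p e).
  apply: (occ_sibling dg) (esym (wedge_tag W)).
  by exists b; rewrite cat_rcons -aE.
have [o [og [c oE sc]]] := isout_exists G_coarse dg po.
have /asrc /=: (o, t, a) \in gedges g; last by rewrite eqxx.
apply/edgeP; split=> //; exists p, e, f, c, b; split=> //.
by rewrite oE cat_rcons.
Qed.

Lemma is_outputP a : is_output g a <-> isout g [::] a.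
Proof.
split=> [[ag asnk]|[ag [a1 /= a1E sa]]]; split=> //; last first.
  rewrite -a1E in sa.
  move=> [[c t] b] /edgeP[_ _ [p [e [f [a' [b' [/wedge_snkF W cE _ _ _]]]]]]].
  by apply/eqP => /= ca; move: sa; rewrite -ca cE all_cat /= W andbF.
exists a => //; apply: contraT => /not_allP[p [f [b [aE /snkPn[t [e W]] sb]]]].
have po : occ g (rcons p e).
  apply: (occ_sibling dg) (wedge_tag W).
  by exists b; rewrite cat_rcons -aE.
have [i [ig [c iE sc]]] := isin_exists G_coarse dg po.
have /asnk /=: (a, t, i) \in gedges g; last by rewrite eqxx.
apply/edgeP; split=> //; exists p, f, e, b, c; split=> //.
by rewrite iE cat_rcons.
Qed.

End Derived.

(** The execution is existential here; by safety every execution of [M] realises the same pairs. *)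
Definition lam M q q' : Prop := exists2 g : graph G, execution M g & io_trans g q q'.

Lemma io_transP M g q q' : derives M g -> io_trans g q q' <->
  exists i o, [/\ isin g [::] i, isout g [::] o & reach g i o q q'].
Proof.
move=> dg; split=> [[i [o [p [ii oo io <-]]]]|[i [o [ii oo /reachP[p io <-]]]]].
  exists i, o; split; [exact/(is_inputP dg)|exact/(is_outputP dg)|].
  by apply/reachP; exists p.
exists i, o, p; split=> //; [exact/(is_inputP dg)|exact/(is_outputP dg)].
Qed.

(** State changes from the output of one sibling to the input of a later one: edges of the
    right-hand side alternate with full crossings of the modules in between. *)
Inductive betw : pedge G -> pedge G -> state A -> state A -> Prop :=
| betw_edge e t f q : wedge e t f -> betw e f q (trans q t)
| betw_cons e t f h q q1 q2 : wedge e t f -> lam (pe_dst f) (trans q t) q1 ->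
    betw f h q1 q2 -> betw e h q q2.

(** From the input of a replaced node to the input of its child [f]: either both are the same node,
    or the source child is crossed completely first. *)
Definition enter f q q' : Prop :=
  (src f /\ q = q') \/
  (exists e q1, [/\ src e, tag e = tag f & ~~ src f] /\
     lam (pe_dst e) q q1 /\ betw e f q1 q').

Definition leave e q q' : Prop :=
  (snk e /\ q = q') \/
  (exists f q1, [/\ snk f, tag f = tag e & ~~ snk e] /\
     betw e f q q1 /\ lam (pe_dst f) q1 q').

Fixpoint enters (b : seq (pedge G)) q q' : Prop :=
  if b is f :: b' then exists2 q1, enter f q q1 & enters b' q1 q' else q = q'.

(** A path that leaves a subtree climbs, so the last letter acts first. *)
Fixpoint leaves (a : seq (pedge G)) q q' : Prop :=
  if a is e :: a' then exists2 q1, leaves a' q q1 & leave e q1 q' else q = q'.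

(** * Factorisation of paths in an execution *)

Section Execution.
Variables (M : Sigma) (g : graph G).
Hypothesis exg : execution M g.
Let dg : derives M g := exg.1.

(** This is where safety enters. By convexity a path from the input to the output of a subtree stays
    inside it, so it is a path of the subderivation at [x], which is itself an execution. *)
Lemma reach_lam x i o q q' : occ g x -> isin g x i -> isout g x o ->
  reach g i o q q' <-> lam (node_name M x) q q'.
Proof.
move=> xo [ig [a iE sa]] [og [b oE sb]].
have [g' dg' g'E] := subderivation dg xo.
have exg' : execution (node_name M x) g'.
  split=> // c; rewrite g'E => /(exg.2).
  by rewrite /node_name map_cat last_cat.
have edgeE c t d : (c, t, d) \in gedges g' <-> (x ++ c, t, x ++ d) \in gedges g.
  rewrite (edgeP dg') (edgeP dg) !g'E; split=> -[cg d_g [p [e [f [c' [d' [W cE dE sc sd]]]]]]].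
    split=> //; exists (x ++ p), e, f, c', d'; rewrite cE dE !catA; split=> //.
  split=> //; have [p' pE] := prefix_diverge (wedge_neq W) cE dE.
  exists p', e, f, c', d'; split=> //.
    by apply/eqP; move/eqP: cE; rewrite pE -catA eqseq_cat // eqxx.
  by apply/eqP; move/eqP: dE; rewrite pE -catA eqseq_cat // eqxx.
have reachE c d r r' : reach g' c d r r' <-> reach g (x ++ c) (x ++ d) r r'.
  split; first elim=> {c d r r'} [c r|c t d c' r r' cd _].
  - exact: reach_nil.
  - by apply: reach_cons; apply/edgeE.
  move cE: (x ++ c) => xc; move dE: (x ++ d) => xd xcd.
  elim: xcd c d cE dE => {xc xd r r'} [c0 r c d <- /eqP|c0 t d0 d1 r r' cd dd IH c d cE dE].
    by rewrite eqseq_cat // eqxx /= => /eqP->; constructor.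
  rewrite -cE in cd; rewrite -dE in dd.
  have [d' d0E] := reach_convex dg cd dd; apply: (@reach_cons _ _ t d').
    by apply/edgeE; rewrite -d0E.
  exact: IH.
have i' : isin g' [::] a by split; [rewrite g'E -iE|exists a].
have o' : isout g' [::] b by split; [rewrite g'E -oE|exists b].
rewrite iE oE -reachE; split=> [ab|[ex exM /(A_safe exM exg')]].
  by exists g' => //; apply/(io_transP _ _ dg'); exists a, b.
case/(io_transP _ _ dg')=> a' [b' [i'' o'' ab']].
by rewrite (isin_inj G_coarse dg' i' i'') (isout_inj G_coarse dg' o' o'').
Qed.

Lemma reach_lam_rcons p e i o q q' : isin g (rcons p e) i -> isout g (rcons p e) o ->
  reach g i o q q' <-> lam (pe_dst e) q q'.
Proof.
move=> ii oo; rewrite (reach_lam _ _ (ext_occ ii) ii oo).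
by rewrite /node_name map_rcons last_rcons.
Qed.

Lemma betw_reach p e h o i q q' : isout g (rcons p e) o -> isin g (rcons p h) i ->
  betw e h q q' -> reach g o i q q'.
Proof.
move=> oo ii eh; elim: eh o oo ii => {e h q q'} [e t f q W|e t f h q q1 q2 W l _ IH] o oo ii.
  apply: (@reach_cons _ _ t i) (reach_nil _ _ _); apply/(edgeP dg).
  case: oo ii => [og [a oE sa]] [ig [b iE sb]]; split=> //.
  by exists p, e, f, a, b; rewrite -!cat_rcons.
have fo : occ g (rcons p f) by apply: (occ_sibling dg (ext_occ oo)); apply: wedge_tag W.
have [i' ii'] := isin_exists G_coarse dg fo; have [o' oo'] := isout_exists G_coarse dg fo.
apply: (@reach_cons _ _ t i').
  apply/(edgeP dg).
  case: oo ii' => [og [a oE sa]] [ig [b iE sb]]; split=> //.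
  by exists p, e, f, a, b; rewrite -!cat_rcons.
by apply: reach_trans (IH o' oo' ii); apply/(reach_lam_rcons _ _ ii' oo').
Qed.

Lemma reach_betw p e h o i q q' : isout g (rcons p e) o -> isin g (rcons p h) i ->
  e != h -> reach g o i q q' -> betw e h q q'.
Proof.
(* The measure counts the nodes of the right-hand side from [e] on, in its topological order. *)
move=> oo ii; move: {2}(_ - _) (leqnn (#|wnode (rhs (tag h))| - pe_rank e)) => n.
elim: n e o q oo => [|n IH] e o q oo le_n eh oi.
  have eh' : tag e = tag h.
    have [[a ag] [b bg]] := (ext_occ oo, ext_occ ii).
    by rewrite !cat_rcons in ag bg; apply: consistent dg _ _ _ _ _ ag bg.
  have: pe_rank e < #|wnode (rhs (tag e))| := ltn_ord _.
  by rewrite eh' ltnNge -subn_eq0 -leqn0 le_n.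
have [a oE sa] := oo.2; have [b iE sb] := ii.2.
have [[oi' _]|[t [c [oc ci]]]] := reach_inv oi.
  move: oE; rewrite oi' iE => /(congr1 (prefix (rcons p e))).
  by rewrite prefix_prefix prefix_rcons_disjoint.
have [d cE] : exists d : seq (pedge G), c = p ++ d.
  move: (oc) (ci); rewrite oE iE !cat_rcons => oc' ci'.
  exact: (reach_convex dg oc' ci').
have [og cg [p' [e' [f [a' [d' [W oE' cE' sa' sd']]]]]]] := (edgeP dg _ _ _).1 oc.
case: d cE => [|f0 d] cE.
  move: og; rewrite oE cat_rcons => og.
  by have := antichain dg cg; rewrite cE cats0 => /(_ _ og).
(* All letters of [o] below [e] are sinks, whereas the origin of an edge of a right-hand side is not
   one. So the next edge leaves the subtree of [e], and [diverge] locates it between children of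
   [p]. *)
have ef0 : e != f0.
  apply/eqP => ef0; rewrite -ef0 -cat_rcons in cE; rewrite oE in oE'.
  have [p2 p'E] := prefix_diverge (wedge_neq W) oE' (etrans (esym cE) cE').
  move/eqP: oE'; rewrite p'E -catA eqseq_cat // eqxx /= => /eqP aE.
  by move: sa; rewrite aE all_cat /= (wedge_snkF W) andbF.
rewrite oE cat_rcons in oE'; rewrite cE in cE'.
have [pp' ee' ff' aa dd'] := diverge oE' cE' ef0 (wedge_neq W).
rewrite -?pp' -?ee' -?ff' -?aa -?dd' in W cE' oE' sa' sd' => {pp' ee' ff' aa dd' p' e' f a' d'}.
have ci' : isin g (rcons p f0) c by split=> //; exists d; rewrite ?cat_rcons.
have [f0h|nf0h] := eqVneq f0 h.
  move: ci ci'; rewrite f0h => ci ci'.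
  rewrite (isin_inj G_coarse dg ci' ii) in ci.
  by rewrite -(reach_same dg ci); apply: betw_edge; rewrite -f0h.
rewrite cE -cat_rcons in ci.
have xi : ~~ prefix (rcons p f0) i by rewrite iE prefix_rcons_disjoint.
have [o' [r [oo' co' oi']]] := reach_leave dg ci xi.
rewrite cat_rcons -cE in co'.
apply: (betw_cons W ((reach_lam_rcons _ _ ci' oo').1 co')).
apply: IH oo' _ nf0h oi'.
have ef := wedge_rank W; rewrite !leq_subLR in le_n *.
by apply: leq_trans le_n _; rewrite -addSnnS leq_add2r.
Qed.

Lemma reach_first x f i j q q' : x \notin gnodes g -> isin g x i ->
  isin g (rcons x f) j -> reach g i j q q' <-> enter f q q'.
Proof.
move=> xg ii jj; have [ig [b iE sb]] := ii.
case: b iE sb => [|s b] iE /= sb; first by rewrite iE cats0 (negbTE xg) in ig.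
case/andP: sb => ss sb.
have sf : tag s = tag f.
  have [c cg] := ext_occ jj; rewrite iE in ig; rewrite cat_rcons in cg.
  exact: consistent dg _ _ _ _ _ ig cg.
have si : isin g (rcons x s) i by split=> //; exists b; rewrite ?cat_rcons.
have [fs|nsf] := boolP (src f).
  have fE := src_inj G_coarse ss fs sf; rewrite fE in si.
  rewrite (isin_inj G_coarse dg si jj); split=> [ij|[[_ ->]|[e [q1 [[_ _]]]]]].
  - by left; split=> //; apply: (reach_same dg) ij.
  - exact: reach_nil.
  - by rewrite fs.
have sNf : s != f by apply: contraNneq nsf => <-.
have [o so] := isout_exists G_coarse dg (ext_occ si).
split=> [ij|[[fs]|[e [q1 [[es ef _] [el eb]]]]]].
- have xj : ~~ prefix (rcons x s) j.
    by have [c -> _] := jj.2; rewrite prefix_rcons_disjoint.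
  have iE' : i = rcons x s ++ b by rewrite iE cat_rcons.
  rewrite iE' in ij; have [o' [q1 [so' io' oj']]] := reach_leave dg ij xj.
  right; exists s, q1; split=> //; split.
    by apply/(reach_lam_rcons _ _ si so'); rewrite iE'.
  exact: reach_betw so' jj sNf oj'.
- by rewrite fs in nsf.
have se : s = e by apply: src_inj => //; rewrite ef.
rewrite -se in el eb.
by apply: (reach_trans (b := o)); [apply/(reach_lam_rcons _ _ si so)|apply: betw_reach so jj eb].
Qed.

Lemma reach_last x f o j q q' : x \notin gnodes g -> isout g x o ->
  isout g (rcons x f) j -> reach g j o q q' <-> leave f q q'.
Proof.
move=> xg oo jj; have [og [b oE sb]] := oo.
case: b oE sb => [|s b] oE /= sb; first by rewrite oE cats0 (negbTE xg) in og.
case/andP: sb => ss sb.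
have sf : tag s = tag f.
  have [c cg] := ext_occ jj; rewrite oE in og; rewrite cat_rcons in cg.
  exact: consistent dg _ _ _ _ _ og cg.
have so : isout g (rcons x s) o by split=> //; exists b; rewrite ?cat_rcons.
have [fs|nsf] := boolP (snk f).
  have fE := snk_inj G_coarse ss fs sf; rewrite fE in so.
  rewrite (isout_inj G_coarse dg so jj); split=> [ij|[[_ ->]|[e [q1 [[_ _]]]]]].
  - by left; split=> //; apply: (reach_same dg) ij.
  - exact: reach_nil.
  - by rewrite fs.
have sNf : f != s by apply: contraNneq nsf => ->.
have [i si] := isin_exists G_coarse dg (ext_occ so).
split=> [jo|[[fs]|[e [q1 [[es ef _] [eb el]]]]]].
- have xj : ~~ prefix (rcons x s) j.
    by have [c -> _] := jj.2; rewrite prefix_rcons_disjoint // eq_sym.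
  have oE' : o = rcons x s ++ b by rewrite oE cat_rcons.
  rewrite oE' in jo; have [i' [q1 [si' ji' io']]] := reach_enter dg jo xj.
  right; exists s, q1; split=> //; split.
    exact: reach_betw jj si' sNf ji'.
  by apply/(reach_lam_rcons _ _ si' so); rewrite oE'.
- by rewrite fs in nsf.
have se : s = e by apply: snk_inj => //; rewrite ef.
rewrite -se in el eb.
by apply: (reach_trans (b := i)); [apply: betw_reach jj si eb|apply/(reach_lam_rcons _ _ si so)].
Qed.

Lemma strict_notin x e b : x ++ e :: b \in gnodes g -> x \notin gnodes g.
Proof. by move=> xb; apply/negP => /(antichain dg)/(_ xb). Qed.

Lemma reach_enters x i b q q' : isin g x i -> x ++ b \in gnodes g ->
  reach g i (x ++ b) q q' <-> enters b q q'.
Proof.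
elim: b x i q => [|f b IH] x i q ii xb /=.
  rewrite cats0 in xb *; have [ig [c iE _]] := ii.
  rewrite iE in ig; have c0 := antichain dg xb ig; rewrite iE c0 cats0.
  by split=> [/(reach_same dg)//|->]; apply: reach_nil.
have xg := strict_notin xb; rewrite -cat_rcons in xb *.
have fo : occ g (rcons x f) by exists b.
have [j jj] := isin_exists G_coarse dg fo.
split=> [ib|[q1 /(reach_first _ _ xg ii jj) ij /(IH _ _ _ jj xb)]]; last exact: reach_trans.
have [xi|xi] := boolP (prefix (rcons x f) i); last first.
  have [j' [q1 [jj' ij' jb]]] := reach_enter dg ib xi.
  exists q1; first exact/(reach_first _ _ xg ii jj').
  exact/(IH _ _ _ jj' xb).
(* The input of [x] already lies below [f], so it is the input of that child as well. *)
have ij : i = j.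
  apply: (isin_inj G_coarse dg _ jj).
  case: ii => ig [c iE sc]; move: xi; rewrite iE => /prefixP[d].
  rewrite cat_rcons => /eqP; rewrite eqseq_cat // eqxx => /eqP cE.
  move: sc; rewrite cE /= => /andP[_ sd].
  split; first by rewrite -cE -iE.
  by exists d; rewrite // cat_rcons.
exists q; last by apply/(IH _ _ _ jj xb); rewrite -ij.
by apply/(reach_first _ _ xg ii jj); rewrite ij; apply: reach_nil.
Qed.

Lemma reach_leaves x o b q q' : isout g x o -> x ++ b \in gnodes g ->
  reach g (x ++ b) o q q' <-> leaves b q q'.
Proof.
elim: b x o q' => [|f b IH] x o q' oo xb /=.
  rewrite cats0 in xb *; have [og [c oE _]] := oo.
  rewrite oE in og; have c0 := antichain dg xb og; rewrite oE c0 cats0.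
  by split=> [/(reach_same dg)//|->]; apply: reach_nil.
have xg := strict_notin xb; rewrite -cat_rcons in xb *.
have fo : occ g (rcons x f) by exists b.
have [j jj] := isout_exists G_coarse dg fo.
split=> [bo|[q1 /(IH _ _ _ jj xb) bj /(reach_last _ _ xg oo jj)]]; last exact: reach_trans.
have [xi|xi] := boolP (prefix (rcons x f) o); last first.
  have [j' [q1 [jj' bj' jo]]] := reach_leave dg bo xi.
  exists q1; last exact/(reach_last _ _ xg oo jj').
  exact/(IH _ _ _ jj' xb).
have oj : o = j.
  apply: (isout_inj G_coarse dg _ jj).
  case: oo => og [c oE sc]; move: xi; rewrite oE => /prefixP[d].
  rewrite cat_rcons => /eqP; rewrite eqseq_cat // eqxx => /eqP cE.
  move: sc; rewrite cE /= => /andP[_ sd].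
  split; first by rewrite -cE -oE.
  by exists d; rewrite // cat_rcons.
exists q'; first by apply/(IH _ _ _ jj xb); rewrite -oj.
by apply/(reach_last _ _ xg oo jj); rewrite oj; apply: reach_nil.
Qed.

Lemma reach_split p e f a b q q' : e != f ->
  p ++ e :: a \in gnodes g -> p ++ f :: b \in gnodes g ->
  reach g (p ++ e :: a) (p ++ f :: b) q q' <->
  exists q1 q2, [/\ leaves a q q1, betw e f q1 q2 & enters b q2 q'].
Proof.
move=> ef; rewrite -!cat_rcons => eg fg.
have eo : occ g (rcons p e) by exists a.
have fo : occ g (rcons p f) by exists b.
split=> [ab|[q1 [q2 [la bt eb]]]].
  have xb : ~~ prefix (rcons p e) (rcons p f ++ b) by rewrite prefix_rcons_disjoint.
  have [o [q1 [oo ao ob]]] := reach_leave dg ab xb.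
  have xo : ~~ prefix (rcons p f) o.
    by have [c -> _] := oo.2; rewrite prefix_rcons_disjoint // eq_sym.
  have [i [q2 [ii oi ib]]] := reach_enter dg ob xo.
  exists q1, q2; split; [exact/(reach_leaves _ _ oo eg)|exact: reach_betw oo ii ef oi|].
  exact/(reach_enters _ _ ii fg).
have [o oo] := isout_exists G_coarse dg eo; have [i ii] := isin_exists G_coarse dg fo.
apply: (reach_trans ((reach_leaves _ _ oo eg).2 la)).
exact: (reach_trans (betw_reach oo ii bt) ((reach_enters _ _ ii fg).2 eb)).
Qed.

End Execution.
End Reachability.

(** * Constant-time decision trees *)

(** Arguments that an ultimately periodic function with preperiod at most [K] and period dividing
    [P] cannot tell apart. *)
Definition eqv (K P a b : nat) : bool :=
  (a == b) || [&& K <= a, K <= b & a == b %[mod P]].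

Section DecisionTree.
Variables (B K P : nat).

Variant test := Tlt of nat & nat | Teq of nat & nat & nat | Tmod of nat & nat & nat.

Definition test_key (c : test) : nat * nat * nat * nat :=
  match c with
  | Tlt a b => (a, b, 0, 0)
  | Teq a b r => (a, b, 1, r)
  | Tmod a b r => (a, b, 2, r)
  end.

Definition key_test (k : nat * nat * nat * nat) : test :=
  match k with
  | (a, b, 0, _) => Tlt a b
  | (a, b, 1, r) => Teq a b r
  | (a, b, _, r) => Tmod a b r
  end.

Lemma test_keyK : cancel test_key key_test. Proof. by case. Qed.

HB.instance Definition _ := Equality.copy test (can_type test_keyK).

Definition test_wf (c : test) : bool :=
  match c with
  | Tlt a b => (a < B) && (b < B)
  | Teq a b r => [&& a < B, b < B & r < K]
  | Tmod a b r => [&& a < B, b < B & r < P]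
  end.

(** Cells [B] and [B.+1] are scratch space; the inspected cells lie below [B] and survive every
    test. *)
Definition test_code (c : test) : seq instr :=
  match c with
  | Tlt a b => [:: IOp OLt B a b]
  | Teq a b r => [:: IOp OSub B a b; IConst B.+1 r; IOp OEq B B B.+1]
  | Tmod a b r => [:: IOp OSub B a b; IConst B.+1 P; IOp OMod B B B.+1;
                   IConst B.+1 r; IOp OEq B B B.+1]
  end.

Definition test_val (w : nat) (m : memory) (c : test) : bool :=
  match c with
  | Tlt a b => m a < m b
  | Teq a b r => (m a + (2 ^ w - m b)) %% 2 ^ w == r
  | Tmod a b r => (m a + (2 ^ w - m b)) %% 2 ^ w %% P == r
  end.

Definition straight w (m : memory) (i : instr) : memory :=
  match i with
  | IConst d c => write w m d c
  | IOp o d a b => write w m d (eval_op w o (read w m a) (read w m b))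
  | _ => m
  end.

Definition is_straight (i : instr) : bool :=
  match i with IConst _ _ | IOp _ _ _ _ => true | _ => false end.

Lemma onth_size_cat (T : Type) (s : seq T) x s' : onth (s ++ x :: s') (size s) = Some x.
Proof. by elim: s. Qed.

Local Arguments onth : simpl never.

Lemma exec_straight w c pre post t m : all is_straight c ->
  exec w (pre ++ c ++ post) (size c + t) (size pre) m =
  exec w (pre ++ c ++ post) t (size pre + size c) (foldl (straight w) m c).
Proof.
elim: c pre m => [|i c IH] pre m /=; first by rewrite addn0.
case/andP=> si sc; rewrite onth_size_cat -cat_rcons addnS -addSn -(size_rcons pre i).
by case: i si => // *; rewrite IH.
Qed.

Lemma test_codeP w m0 m c : test_wf c -> B.+1 < 2 ^ w -> K <= 2 ^ w -> P < 2 ^ w ->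
  (forall a, a < B -> m0 a < 2 ^ w) -> (forall a, a < B -> m a = m0 a) ->
  let m' := foldl (straight w) m (test_code c) in
  (m' B != 0) = test_val w m0 c /\ (forall a, a < B -> m' a = m0 a).
Proof.
move=> wf Bw Kw Pw m0w mm0.
have w1 : 1 < 2 ^ w by apply: leq_trans Bw.
have bw (x : bool) : x %% 2 ^ w = x.
  by rewrite modn_small //; case: x; rewrite // (ltn_trans _ w1).
have BSB : (B.+1 == B) = false by rewrite gtn_eqF.
have BBS : (B == B.+1) = false by rewrite ltn_eqF.
have Bw' : B < 2 ^ w by apply: ltnW.
case: c wf => [a b /andP[aB bB]|a b r /and3P[aB bB rK]|a b r /and3P[aB bB rP]] /=;
  have aw := ltn_trans aB Bw'; have bw' := ltn_trans bB Bw';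
  rewrite /write /read ?(modn_small Bw) ?(modn_small Bw') ?(modn_small aw) ?(modn_small bw')
    ?eqxx ?BSB ?BBS ?eqxx ?bw ?mm0 //.
- split=> [|a' a'B]; first by rewrite eqb0 negbK.
  by rewrite ltn_eqF ?mm0.
- rewrite (modn_small (leq_trans rK Kw)); split=> [|a' a'B]; first by rewrite eqb0 negbK.
  by rewrite !ltn_eqF ?mm0 // ltnW.
rewrite (modn_small Pw) (modn_small (ltn_trans rP Pw)) (@modn_small (_ %% P)).
  split=> [|a' a'B]; first by rewrite eqb0 negbK.
  by rewrite !ltn_eqF ?mm0 // ltnW.
by apply: ltn_trans Pw; rewrite ltn_mod (leq_ltn_trans _ rP).
Qed.

Lemma test_code_straight c : all is_straight (test_code c).
Proof. by case: c. Qed.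

(** Jumps are absolute, hence the offset [off]. Every branch performs all tests, so all inputs take
    exactly [decision_time] steps; [f] is the table of answers. *)
Fixpoint decision_tree off (ts : seq test) (f : bitseq -> bool) : seq instr :=
  if ts is c :: ts' then
    let o1 := off + (size (test_code c)).+1 in
    let l := decision_tree o1 ts' (f \o cons true) in
    test_code c ++ IJumpZero B (o1 + size l) ::
    l ++ decision_tree (o1 + size l) ts' (f \o cons false)
  else [:: IConst B (f [::]); IHalt B].

Definition decision_time (ts : seq test) := sumn [seq (size (test_code c)).+1 | c <- ts] + 2.

Lemma decision_treeP w m0 ts f pre post m : all test_wf ts ->
  B.+1 < 2 ^ w -> K <= 2 ^ w -> P < 2 ^ w ->
  (forall a, a < B -> m0 a < 2 ^ w) -> (forall a, a < B -> m a = m0 a) ->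
  exec w (pre ++ decision_tree (size pre) ts f ++ post) (decision_time ts) (size pre) m =
  Some (f [seq test_val w m0 c | c <- ts]).
Proof.
move=> + Bw Kw Pw m0w; elim: ts f pre post m => [|c ts IH] f pre post m.
  move=> _ _ /=; rewrite onth_size_cat /= -cat_rcons.
  rewrite -(size_rcons pre (IConst B (f [::]))) onth_size_cat.
  rewrite /read /write eqxx modn_small; first by case: (f _).
  exact: leq_ltn_trans (leq_b1 _) (leq_ltn_trans _ Bw).
rewrite [all _ _]/= [decision_tree _ _ _]/= => /andP[wfc wfs] mm0.
have -> : decision_time (c :: ts) = size (test_code c) + (decision_time ts).+1.
  by rewrite /decision_time /= -addnA addSnnS.
rewrite -catA exec_straight ?test_code_straight //.
have [m'B m'm0] := test_codeP wfc Bw Kw Pw m0w mm0.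
set m' := foldl _ _ _ in m'B m'm0 *.
rewrite catA -size_cat /= onth_size_cat.
rewrite /read (modn_small (ltnW Bw)) /=.
set l := decision_tree _ _ (f \o cons true).
set r := decision_tree _ _ (f \o cons false).
set J := IJumpZero _ _.
have -> : (pre ++ test_code c) ++ (J :: l ++ r) ++ post =
          rcons (pre ++ test_code c) J ++ l ++ (r ++ post).
  by rewrite cat_rcons /= -!catA.
rewrite -(size_rcons (pre ++ test_code c) J).
have o1 : size pre + (size (test_code c)).+1 = size (rcons (pre ++ test_code c) J).
  by rewrite size_rcons size_cat addnS.
move: m'B; case: eqP => _ /= <-; last first.
  by rewrite /l o1 IH.
have -> : rcons (pre ++ test_code c) J ++ l ++ r ++ post =
   (rcons (pre ++ test_code c) J ++ l) ++ r ++ post by rewrite catA.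
have o2 : size pre + (size (test_code c)).+1 + size l = size (rcons (pre ++ test_code c) J ++ l).
  by rewrite size_cat o1.
by rewrite /r o2 IH.
Qed.

Definition all_tests : seq test :=
  flatten [seq Tlt ab.1 ab.2 ::
           [seq Teq ab.1 ab.2 r | r <- iota 0 K] ++ [seq Tmod ab.1 ab.2 r | r <- iota 0 P]
          | ab <- [seq (a, b) | a <- iota 0 B, b <- iota 0 B]].

Lemma all_tests_wf : all test_wf all_tests.
Proof.
apply/allP => c /flattenP[s /mapP[ab /allpairsP[[a b] /= [+ + ->]] ->]] /=.
rewrite !mem_iota !add0n /= => aB bB.
rewrite inE mem_cat => /or3P[/eqP->|/mapP[r]|/mapP[r]]; first by rewrite /= aB.
  by rewrite mem_iota add0n => rK ->; rewrite /= aB bB.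
by rewrite mem_iota add0n => rK ->; rewrite /= aB bB.
Qed.

(** Subtraction is truncated and both orders of [a] and [b] are covered, so for [0 < K] the
    comparison of two cells is fixed too. *)
Definition csim (m1 m2 : memory) : Prop :=
  forall a b, a < B -> b < B -> eqv K P (m1 a - m1 b) (m2 a - m2 b).

(** The word sizes may differ: once [Tlt] has excluded a negative difference, the subtraction modulo
    [2 ^ w] is exact, and the outcomes speak of true differences. *)
Lemma tests_csim w1 w2 m1 m2 : 0 < P ->
  (forall a, a < B -> m1 a < 2 ^ w1) -> (forall a, a < B -> m2 a < 2 ^ w2) ->
  [seq test_val w1 m1 c | c <- all_tests] = [seq test_val w2 m2 c | c <- all_tests] ->
  csim m1 m2.
Proof.
move=> P0 m1w m2w /eq_in_map E a b aB bB.
have E' c : c \in Tlt a b ::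
    [seq Teq a b r | r <- iota 0 K] ++ [seq Tmod a b r | r <- iota 0 P] ->
    test_val w1 m1 c = test_val w2 m2 c.
  move=> cE; apply: E; apply/flattenP.
  exists (Tlt a b :: [seq Teq a b r | r <- iota 0 K] ++ [seq Tmod a b r | r <- iota 0 P]) => //.
  by apply/mapP; exists (a, b) => //; apply: allpairs_f; rewrite mem_iota.
have ltE : (m1 a < m1 b) = (m2 a < m2 b) by apply: (E' (Tlt a b)); rewrite inE eqxx.
have [lt1|le1] := ltnP (m1 a) (m1 b).
  move: (ltE); rewrite lt1 => /esym lt2; apply/orP; left.
  by rewrite (eqP (ltnW lt1 : _ - _ == 0)) (eqP (ltnW lt2 : _ - _ == 0)).
have le2 : m2 b <= m2 a by rewrite leqNgt -ltE -leqNgt.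
have sub w (m : memory) : (forall a, a < B -> m a < 2 ^ w) -> m b <= m a ->
    (m a + (2 ^ w - m b)) %% 2 ^ w = m a - m b.
  move=> mw le; rewrite addnBA ?(ltnW (mw b bB)) // addnC -addnBA // modnDl modn_small //.
  exact: leq_ltn_trans (leq_subr _ _) (mw a aB).
have s1 := sub _ _ m1w le1; have s2 := sub _ _ m2w le2.
have eqE r : r < K -> (m1 a - m1 b == r) = (m2 a - m2 b == r).
  move=> rK; have := E' (Teq a b r); rewrite /= s1 s2; apply.
  by rewrite inE mem_cat map_f ?orbT // mem_iota.
have [lt1|ge1] := ltnP (m1 a - m1 b) K.
  by apply/orP; left; rewrite eq_sym -(eqE _ lt1).
have [lt2|ge2] := ltnP (m2 a - m2 b) K.
  by apply/orP; left; rewrite (eqE _ lt2).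
apply/orP; right; rewrite ge1 ge2 /=.
have rP : (m1 a - m1 b) %% P < P by rewrite ltn_mod.
have := E' (Tmod a b ((m1 a - m1 b) %% P)); rewrite /= s1 s2 eqxx eq_sym => <- //.
by rewrite inE mem_cat (map_f (Tmod a b)) ?orbT // mem_iota.
Qed.

(* The answer of a decision tree on all tests can be any function of their
   outcomes, so a program exists for every problem that is invariant under
   [csim]. *)
Lemma csim_computable (I : nat -> seq nat -> bool -> Prop) : 0 < P ->
  (forall w1 w2 in1 in2 b1 b2, I w1 in1 b1 -> I w2 in2 b2 ->
     csim (load_input w1 in1) (load_input w2 in2) -> b1 = b2) ->
  exists prog time w0, forall w inp b, w0 <= w -> I w inp b ->
    computes w prog time inp b.
Proof.
move=> P0 Iinv.
pose outcome w inp := [seq test_val w (load_input w inp) c | c <- all_tests].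
(* The table quantifies over all word sizes and inputs at once; [Iinv] makes its value correct for
   each input with these outcomes. *)
pose f s := `[< exists w inp, I w inp true /\ outcome w inp = s >].
have ltw w inp a : a < B -> load_input w inp a < 2 ^ w by rewrite ltn_mod expn_gt0.
(* This word size makes the scratch addresses and the constants of the tests fit, because
   [w < 2 ^ w]. *)
exists (decision_tree 0 all_tests f), (decision_time all_tests), (B.+2 + K + P) => w inp b w0 Ib.
have w2 : w < 2 ^ w by apply: ltn_expl.
have := @decision_treeP w (load_input w inp) all_tests f [::] [::] (load_input w inp) all_tests_wf.
rewrite cats0 /computes => /= -> //; [|lia|lia|lia|exact: ltw].
congr Some; rewrite -/(outcome w inp); apply/asboolP/idP => [[w' [inp' [It oE]]]|bt].
  rewrite -(Iinv _ _ _ _ _ _ It Ib) //.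
  by apply: tests_csim P0 (ltw _ _) (ltw _ _) oE.
by exists w, inp; split=> //; case: b Ib bt.
Qed.

End DecisionTree.

(** * Periodicity in labels *)

Section PeriodicIteration.
Variables (U : finType) (F : U -> U).

(** The orbit of [x] is a tail of length [i] followed by a loop of length [d], which together have
    at most [#|U|] points. *)
Lemma iter_period x : exists i d, [/\ 0 < d, i + d <= #|U| &
  forall a m, i <= a -> iter (a + m * d) F x = iter a F x].
Proof.
have /trajectP[i io iE] := looping_order F x.
exists i, (order F x - i); split; first by rewrite subn_gt0.
  by rewrite subnKC ?max_card // ltnW.
have per m : iter (i + m * (order F x - i)) F x = iter i F x.
  elim: m => [|m IH]; first by rewrite addn0.
  rewrite mulSn addnA addnC iterD subnKC; last exact: ltnW.
  by rewrite iE -iterD addnC IH.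
by move=> a m ia; rewrite -(subnKC ia) addnAC addnC iterD per -iterD addnC.
Qed.

Lemma iter_eqv K P x a b : #|U| <= K -> (forall d, 0 < d <= #|U| -> d %| P) ->
  eqv K P a b -> iter a F x = iter b F x.
Proof.
move=> UK dP /orP[/eqP->//|/and3P[Ka Kb /eqP ab]].
have [i [d [d0 idU per]]] := iter_period x.
wlog le_ab : a b Ka Kb ab / a <= b => [wl|].
  by case/orP: (leq_total a b) => /wl; [|move=> wl'; symmetry]; auto.
have /dvdnP[m mE] : d %| b - a.
  apply: (@dvdn_trans P); first by rewrite dP // d0 (leq_trans (leq_addl i d)).
  by rewrite -eqn_mod_dvd //; apply/eqP.
rewrite -(subnKC le_ab) mE per // (leq_trans _ Ka) // (leq_trans _ UK) //.
exact: (leq_trans (leq_addr d i)).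
Qed.
End PeriodicIteration.

Lemma eqv_small K P a b : a < K -> eqv K P a b -> a = b.
Proof. by move=> aK /orP[/eqP//|/and3P[Ka _ _]]; lia. Qed.

Lemma eqv_mod K P d a b : d %| P -> eqv K P a b -> a = b %[mod d].
Proof.
move=> dP /orP[/eqP->//|/and3P[_ _ /eqP ab]].
by rewrite -(modn_dvdm a dP) ab modn_dvdm.
Qed.

(** Moving the position on the cycle along with the accumulator turns the fold into an iteration on
    pairs, to which [iter_eqv] applies. *)
Lemma foldl_traject (L T : Type) (f : L -> L) (stp : T -> L -> T) e x j :
  foldl stp x (traject f e j) =
  (iter j (fun p => (f p.1, stp p.2 p.1)) (e, x)).2.
Proof. by elim: j e x => // j IH e x; rewrite iterSr -IH. Qed.

(** * Similarity of labels, read off the memory *)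

Section LabelSimilarity.
Variables (L : Type) (cs : seq (seq L)) (K P : nat).

(** Start edges are compared modulo the cycle length because [answer] shifts them by indices known
    only up to [eqv]; [n == 0] covers the default empty cycle of an out-of-range [s]. *)
Definition lsim (l1 l2 : tree_label) : bool :=
  match l1, l2 with
  | LProd k i, LProd k' i' => (k == k') && (i == i')
  | LRec s t j, LRec s' t' j' =>
      let n := size (nth [::] cs s) in
      [&& s == s', (n == 0) || (t == t' %[mod n]) & eqv K P j j']
  | _, _ => false
  end.

Definition psim (l1 l2 : tree_label * tree_label) : bool :=
  match l1, l2 with
  | (LRec _ _ j1, LRec _ _ j1'), (LRec _ _ j2, LRec _ _ j2') =>
      eqv K P (j1 - j1') (j2 - j2') && eqv K P (j1' - j1) (j2' - j2)
  | _, _ => true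
  end.

Lemma all2_nth (X Y : Type) (r : X -> Y -> bool) x0' y0 l1 l2 : size l1 = size l2 ->
  (forall p, p < size l1 -> r (nth x0' l1 p) (nth y0 l2 p)) -> all2 r l1 l2.
Proof.
elim: l1 l2 => [|x l1 IH] [|y l2] //= [sE] rP.
by rewrite (rP 0) //=; apply: IH => // p /(rP p.+1).
Qed.

Definition bounded C (l : tree_label) : bool :=
  match l with
  | LProd k i => (k < C) && (i < C)
  | LRec s t _ => (s < C) && (t < C)
  end.

Lemma nth_encode (ls : seq tree_label) s p r : p < size ls -> r < 4 ->
  nth 0 (flatten [seq encode_tree_label l | l <- ls] ++ s) (4 * p + r) =
  nth 0 (encode_tree_label (nth (LProd 0 0) ls p)) r.
Proof.
elim: ls p => // l ls IH [|p] pl r4; rewrite /= -?catA nth_cat.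
  by rewrite muln0 add0n; case: l {pl} => [k i|s0 t j] /=; rewrite r4.
have -> : size (encode_tree_label l) = 4 by case: (l).
by rewrite mulnS -addnA ltnNge leq_addr /= addKn IH.
Qed.

Definition label_memory lu lv : memory :=
  nth 0 (encode_label lu ++ encode_label lv).

Lemma size_encode (ls : seq tree_label) :
  size (flatten [seq encode_tree_label l | l <- ls]) = 4 * size ls.
Proof. by elim: ls => //= l ls IH; rewrite size_cat IH mulnS; case: l. Qed.

Lemma label_memoryl lu lv p r : p < size lu -> r < 4 ->
  label_memory lu lv (4 * p + r).+1 = nth 0 (encode_tree_label (nth (LProd 0 0) lu p)) r.
Proof. by move=> pl r4; rewrite /label_memory /= nth_encode. Qed.

Lemma label_memoryr lu lv a :
  label_memory lu lv (4 * size lu + a).+1 = nth 0 (encode_label lv) a.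
Proof. by rewrite /label_memory /= nth_cat size_encode ltnNge leq_addr /= addKn. Qed.

Lemma label_memory1 lu lv : label_memory lu lv (4 * size lu).+1 = size lv.
Proof. by have := label_memoryr lu lv 0; rewrite addn0. Qed.

Lemma label_memoryv lu lv p r : p < size lv -> r < 4 ->
  label_memory lu lv (4 * size lu + (4 * p + r).+1).+1 =
  nth 0 (encode_tree_label (nth (LProd 0 0) lv p)) r.
Proof. by move=> pl r4; rewrite label_memoryr /= -[flatten _]cats0 nth_encode. Qed.

Lemma csim_labels n C lu1 lv1 lu2 lv2 : C <= K -> n < K -> 1 < K ->
  size lu1 <= n -> size lv1 <= n -> size lu2 <= n -> size lv2 <= n ->
  all (bounded C) lu1 -> all (bounded C) lv1 ->
  csim (8 * n).+3 K P (label_memory lu1 lv1) (label_memory lu2 lv2) ->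
  [/\ all2 lsim lu1 lu2, all2 lsim lv1 lv2 & all2 psim (zip lu1 lv1) (zip lu2 lv2)].
Proof.
move=> CK nK K1 su1 sv1 su2 sv2 bu bv sim.
(* Two labels fill at most [2 * (4 * n + 1)] cells, so the last inspected cell is zero, and
   differences with it give the values of the other cells. *)
have z lu lv : size lu <= n -> size lv <= n -> label_memory lu lv (8 * n).+2 = 0.
  move=> su sv; rewrite /label_memory nth_default // size_cat /= !size_encode; lia.
have cell a : a < (8 * n).+3 -> eqv K P (label_memory lu1 lv1 a) (label_memory lu2 lv2 a).
  by move=> aB; have := sim _ _ aB (ltnSn _); rewrite !z // !subn0.
(* Lengths are below [K], hence known exactly; this aligns the entries of both memories, as the
   second label starts where the first one ends. *)
have szu : size lu1 = size lu2.
  by apply: (@eqv_small K P); [apply: leq_ltn_trans nK|exact: (cell 0)].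
have szv : size lv1 = size lv2.
  apply: (@eqv_small K P); first exact: leq_ltn_trans nK.
  by have := cell (4 * size lu1).+1; rewrite label_memory1 szu label_memory1; apply; lia.
have lsimP l1 l2 : bounded C l1 ->
  (forall r, r < 4 -> eqv K P (nth 0 (encode_tree_label l1) r) (nth 0 (encode_tree_label l2) r)) ->
  lsim l1 l2.
  move=> bl1 E; have E0 r := E r; move: (E0 0 isT) (E0 1 isT) (E0 2 isT) (E0 3 isT) => {E E0}.
  case: l1 l2 bl1 => [k i|s t j] [k' i'|s' t' j'] /= /andP[b1 b2] e0 e1 e2 e3.
  - by apply/andP; split; apply/eqP; [apply: eqv_small e1|apply: eqv_small e2]; apply: leq_trans CK.
  - by have := eqv_small (ltnW K1) e0.
  - by have := eqv_small K1 e0.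
  apply/and3P; split=> //; first by apply/eqP; apply: eqv_small e1; apply: leq_trans CK.
  by apply/orP; right; rewrite (@eqv_small K P t t') // (leq_trans b2).
have cu p r : p < size lu1 -> r < 4 ->
  eqv K P (nth 0 (encode_tree_label (nth (LProd 0 0) lu1 p)) r)
          (nth 0 (encode_tree_label (nth (LProd 0 0) lu2 p)) r).
  move=> pl r4; rewrite -(label_memoryl lv1) // -(label_memoryl lv2) -?szu //.
  by apply: cell; lia.
have cv p r : p < size lv1 -> r < 4 ->
  eqv K P (nth 0 (encode_tree_label (nth (LProd 0 0) lv1 p)) r)
          (nth 0 (encode_tree_label (nth (LProd 0 0) lv2 p)) r).
  move=> pl r4; rewrite -(label_memoryv lu1) // -(label_memoryv lu2) -?szv // -szu.
  by apply: cell; lia.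
split.
- apply: (all2_nth (x0' := LProd 0 0) (y0 := LProd 0 0)) => // p pl.
  by apply: lsimP => [|r r4]; [move/(all_nthP (LProd 0 0)): bu; apply|apply: cu].
- apply: (all2_nth (x0' := LProd 0 0) (y0 := LProd 0 0)) => // p pl.
  by apply: lsimP => [|r r4]; [move/(all_nthP (LProd 0 0)): bv; apply|apply: cv].
apply: (all2_nth (x0' := (LProd 0 0, LProd 0 0)) (y0 := (LProd 0 0, LProd 0 0))).
  by rewrite !size_zip szu szv.
move=> p pz; rewrite !nth_zip_cond pz; have := pz; rewrite !size_zip -szu -szv => -> /=.
move: pz; rewrite size_zip leq_min => /andP[pu pv].
(* The cells that hold the last component, for [LRec] the recursion index, of the [p]-th entries of
   the two labels. *)
set a := (4 * p + 3).+1; set b := (4 * size lu1 + a).+1.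
have aB : a < (8 * n).+3 by rewrite /a; lia.
have bB : b < (8 * n).+3 by rewrite /b /a; lia.
have := sim b a bB aB; have := sim a b aB bB.
rewrite (@label_memoryl lu1 lv1 p 3 pu isT : label_memory lu1 lv1 a = _).
rewrite (@label_memoryv lu1 lv1 p 3 pv isT : label_memory lu1 lv1 b = _).
have -> : label_memory lu2 lv2 a = nth 0 (encode_tree_label (nth (LProd 0 0) lu2 p)) 3.
  by rewrite label_memoryl // -szu.
have -> : label_memory lu2 lv2 b = nth 0 (encode_tree_label (nth (LProd 0 0) lv2 p)) 3.
  by rewrite /b szu label_memoryv // -szv.
case: (nth _ lu1 p) => [k i|s t j] //; case: (nth _ lv1 p) => [k i|s' t' j'] //.
case: (nth _ lu2 p) => [k i|s2 t2 j2] //; case: (nth _ lv2 p) => [k i|s2' t2' j2'] //=.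
by move=> -> ->.
Qed.

End LabelSimilarity.

(** * The answer as a function of two labels *)

Section LabelAnswer.
Variables (L : finType) (letters : nat -> nat -> seq L) (cs : seq (seq L)).

Definition decode (l : tree_label) : seq L :=
  match l with
  | LProd k i => letters k i
  | LRec s t j => let c := nth [::] cs s in
      if onth c (t %% size c) is Some e then traject (next c) e j else [::]
  end.

Definition flat (ls : seq tree_label) : seq L := flatten [seq decode l | l <- ls].

Variables (T : finType) (stp : T -> L -> T) (x0 : T) (D : T -> T -> bool) (b0 : bool).

Definition summ ls := foldl stp x0 (flat ls).

(** Equal entries are skipped. Different indices below one recursive node share the smaller number
    of steps; the label with the larger one is then restarted at the shifted edge, and the other one
    has just left the cycle. *)
Fixpoint answer (lu lv : seq tree_label) : bool :=
  match lu, lv with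
  | [::], [::] => b0
  | LProd k i :: lu', LProd k' i' :: lv' =>
      if (k == k') && (i == i') then answer lu' lv' else D (summ lu) (summ lv)
  | LRec s t j :: lu', LRec _ _ j' :: lv' =>
      if j == j' then answer lu' lv'
      else if j < j' then D (summ lu') (summ (LRec s (t + j) (j' - j) :: lv'))
      else D (summ (LRec s (t + j') (j - j') :: lu')) (summ lv')
  | _, _ => false
  end.

Variables (K P : nat).
Hypotheses (K0 : 0 < K) (LK : #|{: L * T}| <= K).
Hypothesis (dP : forall d, 0 < d <= #|{: L * T}| -> d %| P).
Hypothesis (cP : forall c, c \in cs -> 0 < size c -> size c %| P).

Lemma foldl_sim x l1 l2 : all2 (lsim cs K P) l1 l2 ->
  foldl stp x (flat l1) = foldl stp x (flat l2).
Proof.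
elim: l1 l2 x => [|l1 ls1 IH] [|l2 ls2] x //= /andP[l12 ls12].
rewrite /flat /= !foldl_cat -/(flat ls1) -/(flat ls2) (IH _ _ ls12); congr foldl.
case: l1 l2 l12 => [k i|s t j] [k' i'|s' t' j'] //=.
  by case/andP=> /eqP-> /eqP->.
case/and3P=> /eqP<-; case: (nth [::] cs s) => [|e c] /= tt' jj'.
  by rewrite !modn0; case: t t' {tt'} => [|t] [|t'].
rewrite (eqP tt'); case: onth => // e'.
by rewrite !foldl_traject (@iter_eqv _ _ K P _ j j' LK dP jj').
Qed.

(** The cycle length divides [P], so an index known up to [eqv] still determines the position on the
    cycle. *)
Lemma lsim_shift s t1 t2 j1 j2 d1 d2 :
  let n := size (nth [::] cs s) in (n == 0) || (t1 == t2 %[mod n]) ->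
  eqv K P j1 j2 -> eqv K P d1 d2 -> lsim cs K P (LRec s (t1 + j1) d1) (LRec s (t2 + j2) d2).
Proof.
move=> /= + j12 d12; rewrite eqxx d12 andbT /=; case: eqP => //= /eqP; rewrite -lt0n => c0 /eqP t12.
have [sc|cs_s] := ltnP s (size cs); last by rewrite nth_default in c0.
rewrite -modnDml t12 modnDml eqn_modDl; apply/eqP; apply: eqv_mod j12.
by rewrite cP // mem_nth.
Qed.

Lemma answer_sim lu1 lv1 lu2 lv2 : all2 (lsim cs K P) lu1 lu2 -> all2 (lsim cs K P) lv1 lv2 ->
  all2 (psim K P) (zip lu1 lv1) (zip lu2 lv2) -> answer lu1 lv1 = answer lu2 lv2.
Proof.
elim: lu1 lv1 lu2 lv2 => [|l1 lu1 IH] [|l1' lv1] [|l2 lu2] [|l2' lv2] //=.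
  by case: l1 l2 => [k i|s t j] [k' i'|s' t' j'].
case/andP=> l12 s12 /andP[l12' s12'] /andP[pl12 ps12].
have IHs := IH _ _ _ s12 s12' ps12.
case: l1 l1' l2 l2' l12 l12' pl12 => [k i|s t j] [k' i'|s' t' j']
  [k2 i2|s2 t2 j2] [k2' i2'|s2' t2' j2'] //.
  move=> E E'; move: (E) (E') => /= /andP[/eqP kk /eqP ii] /andP[/eqP kk' /eqP ii'] _.
  rewrite IHs -kk -ii -kk' -ii'; congr (if _ then _ else D _ _).
    by apply: foldl_sim; rewrite /= s12 !eqxx.
  by apply: foldl_sim; rewrite /= s12' !eqxx.
move=> E E'; move: (E) (E') => /= /and3P[/eqP ss tt jj] /and3P[/eqP ss' tt' jj'] /andP[sub sub'].
have eq0 a b : eqv K P a b -> (a == 0) = (b == 0).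
  by case/orP=> [/eqP->//|/and3P[Ka Kb _]]; rewrite !eqn0Ngt !(leq_trans K0).
(* [j <= j'] is by definition the vanishing of [j - j'], which [eqv] detects for positive [K]. *)
have le1 : (j <= j') = (j2 <= j2') := eq0 _ _ sub.
have le2 : (j' <= j) = (j2' <= j2) := eq0 _ _ sub'.
rewrite IHs eqn_leq le1 le2 -eqn_leq [j < j']ltnNge le2 -ltnNge.
case: eqP => // _; case: ifP => _; congr (D _ _).
- exact: foldl_sim.
- by apply: foldl_sim; rewrite -ss /= s12' andbT; apply: lsim_shift.
- by apply: foldl_sim; rewrite -ss /= s12 andbT; apply: lsim_shift.
- exact: foldl_sim.
Qed.

End LabelAnswer.

(** * Walks and cycles of the production graph *)

Section Counting.
Variables (Sigma Gamma : finType) (G : grammar Sigma Gamma).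
Hypothesis G_coarse : coarse_grained G.
Implicit Types (e f : pedge G) (g : graph G) (M : Sigma).

Definition branching e : bool := 1 < #|wnode (rhs (tag e))|.

Lemma nonbranching_eq e f : ~~ branching e -> tag e = tag f -> e = f.
Proof.
case: e f => k i [k' j] /= + kk'; case: k' / kk' j => j.
by rewrite /branching /= -leqNgt => /card_le1_eqP/(_ i j isT isT)->.
Qed.

(* Each branching letter of the address [u] accounts for a node of the graph
   outside the subtree in which [u] continues. *)
Lemma count_branching M g : derives M g -> forall u, u \in gnodes g ->
  count branching u < #|` gnodes g|.
Proof.
elim=> {g} [u|g x k s t dg IH xg xk ss st u].
  by rewrite inE => /eqP->; rewrite cardfs1.
have card : #|` gnodes (replace g x s t)| = (#|` gnodes g|).-1 + #|wnode (rhs k)|.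
  rewrite /replace /= cardfsU (_ : fsetI _ _ = fset0)%fset.
    rewrite cardfs0 subn0 (cardfsD1 x (gnodes g)) xg; congr (_ + _).
    rewrite card_imfset /=; first by rewrite cardE.
    by move=> i j /rcons_inj[/eqP]; rewrite eq_Tagged => /eqP.
  apply/fsetP => a; rewrite inE inE; apply/negP => /andP[].
  rewrite in_fsetD1 => /andP[_ ag] /imfsetP[i _ aE].
  by move: ag; rewrite aE /copy -cats1 => /(antichain dg xg).
have g0 : 0 < #|` gnodes g| by rewrite cardfs_gt0; apply/fset0Pn; exists x.
have k0 : 0 < #|wnode (rhs k)| by apply/card_gt0P; exists s.
rewrite card => /in_replaceP[[ug _]|[e ek ->]]; first by have := IH u ug; lia.
have be : branching e = (1 < #|wnode (rhs k)|) by rewrite /branching ek.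
rewrite -cats1 count_cat /= addn0 be; move: (IH x xg) g0 k0.
by case: (ltnP 1 #|wnode (rhs k)|) => /=; move: (count _ _) #|` _| #|_|; lia.
Qed.

Local Notation follows := [rel e f : pedge G | pe_dst e == pe_src f].

Lemma node_sorted M g u : derives M g -> u \in gnodes g -> sorted follows u.
Proof.
move=> dg; have: occ g u -> sorted follows u.
  elim/last_ind: u => // u f IH uo.
  have uo' : occ g u by apply: occ_cat (_ : occ g (u ++ [:: f])); rewrite cats1.
  move/IH: (uo'); have := occ_name dg uo.
  case: u uo {IH uo'} => //= e u _ srcf su; rewrite rcons_path su /= srcf.
  by rewrite /node_name /= last_map.
by move=> ou ug; apply: ou; exists [::]; rewrite cats0.
Qed.

Local Notation adjacent :=
  [rel M M' | [exists e : pedge G, (pe_src e == M) && (pe_dst e == M')]].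

Lemma lift_walk M p : path adjacent M p ->
  exists es : seq (pedge G), map (@pe_dst _ _ G) es = p /\ map (@pe_src _ _ G) es = belast M p.
Proof.
elim: p M => [|M' p IH] M /=; first by exists [::].
case/andP=> /existsP[e /andP[/eqP se /eqP de]] /IH[es [dE sE]].
by exists (e :: es); rewrite /= se de dE sE.
Qed.

Lemma follows_path e s :
  map (@pe_src _ _ G) s = belast (pe_dst e) (map (@pe_dst _ _ G) s) -> path follows e s.
Proof. by elim: s e => //= f s IH e [-> /IH->]; rewrite eqxx. Qed.

(** [is_cycle] demands distinct sources, so the walk back to the source of [e] is shortened on
    modules and then lifted to edges. *)
Lemma closed_on_cycle e p : path follows e p -> pe_dst (last e p) = pe_src e -> on_cycle e.
Proof.
move=> ep lp.
have: path adjacent (pe_dst e) (map (@pe_dst _ _ G) p).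
  elim: p e ep {lp} => //= f p IH e /andP[/eqP ef fp]; rewrite IH // andbT.
  by apply/existsP; exists f; rewrite ef !eqxx.
have: last (pe_dst e) (map (@pe_dst _ _ G) p) = pe_src e by rewrite last_map.
move=> + pth; case/shortenP: pth => p' p'path p'uniq _ lp'.
have [es [dE sE]] := lift_walk p'path.
exists (e :: es); last exact: mem_head.
apply/and3P; split=> //=.
  apply: follows_path; rewrite !map_rcons sE dE -lp' -lastI.
  by rewrite belast_rcons.
by move: p'uniq; rewrite lastI rcons_uniq lp' sE.
Qed.

Definition off_cycle e : bool := ~~ `[< on_cycle e >].

(** Two off-cycle letters have different sources: otherwise the stretch from the first up to the
    second is a closed walk, which puts the first on a cycle. *)
Lemma count_off_cycle u : sorted follows u -> count off_cycle u <= #|Sigma|.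
Proof.
move=> su; rewrite -size_filter -(size_map (@pe_src _ _ G)).
suff /card_uniqP <- : uniq [seq pe_src e | e <- filter off_cycle u] by apply: max_card.
elim: u su => //= e u IH eu; have {}IH := IH (path_sorted eu).
case: ifP => //= /asboolPn oe; rewrite IH andbT.
apply/mapP => -[f]; rewrite mem_filter => /andP[_ fu] ef; apply: oe.
case/splitPr: fu eu => p1 p2; rewrite cat_path /= => /and3P[ep /eqP lf _].
by apply: closed_on_cycle ep _; rewrite lf.
Qed.

Lemma cycle_uniq (c : seq (pedge G)) : is_cycle c -> uniq c.
Proof. by case/and3P=> _ _ /map_uniq. Qed.

Lemma cycle_size (c : seq (pedge G)) : is_cycle c -> size c <= #|{: pedge G}|.
Proof. by move=> /cycle_uniq/card_uniqP<-; apply: max_card. Qed.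

Lemma cycle_recursive (c : seq (pedge G)) e : is_cycle c -> e \in c -> recursive G (pe_dst e).
Proof.
move=> cc ec; exists c => //; apply/mapP; exists (next c e); first by rewrite mem_next.
by case/and3P: cc => _ /next_cycle-/(_ _ ec)/eqP.
Qed.

End Counting.

Section NextCycle.
Variables (L : eqType) (c : seq L) (t : nat) (e : L).
Hypotheses (c_uniq : uniq c) (tc : t < size c).

Lemma next_nth_mod d i : i < size c -> next c (nth d c i) = nth d c (i.+1 %% size c).
Proof.
move=> ic; rewrite next_nth mem_nth //; case: c c_uniq ic => // y p up ip.
rewrite index_uniq //; case: (ltngtP i.+1 (size (y :: p))) => [lt|gt|eq].
- by rewrite modn_small //=; apply: set_nth_default.
- by move: ip; rewrite ltnNge -ltnS gt.
- by rewrite eq modnn /= nth_default //; case: eq => ->.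
Qed.

Lemma iter_next d j : iter j (next c) (nth d c t) = nth d c ((t + j) %% size c).
Proof.
elim: j => [|j IH] /=; first by rewrite addn0 modn_small.
rewrite IH next_nth_mod ?ltn_mod ?(leq_ltn_trans _ tc) //.
by rewrite addnS -addn1 modnDml addn1.
Qed.

Lemma has_traject_next d (P : pred L) : has P c -> has P (traject (next c) (nth d c t) (size c)).
Proof.
case/hasP=> x xc Px; apply/hasP; exists x => //; apply/trajectP.
have ic : index x c < size c by rewrite index_mem.
exists ((index x c + (size c - t)) %% size c); first by rewrite ltn_mod (leq_ltn_trans _ tc).
rewrite iter_next modnDmr addnCA subnKC 1?ltnW // modnDr modn_small //.
by rewrite nth_index.
Qed.

(** Every full turn meets a letter in [P]. With the branching letters for [P], the size of the run
    bounds the index [j]. *)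
Lemma count_traject_next d (P : pred L) j : has P c ->
  j %/ size c <= count P (traject (next c) (nth d c t) j).
Proof.
move=> hP; have c0 : 0 < size c by apply: leq_ltn_trans tc.
rewrite {2}(divn_eq j (size c)); elim: (j %/ size c) => [|q IH] //.
rewrite mulSn -addnA trajectD count_cat.
have -> : iter (size c) (next c) (nth d c t) = nth d c t.
  by rewrite iter_next modnDr modn_small.
by rewrite -add1n leq_add // -has_count has_traject_next.
Qed.

End NextCycle.

(** * Queries and labels *)

Section TreeLabels.
Variables (Sigma Gamma : finType) (G : grammar Sigma Gamma) (N : numbering G).
Hypotheses (G_coarse : coarse_grained G) (G_linear : strictly_linear G).
Implicit Types (e f : pedge G) (x y u v : addr G) (g : graph G).

Definition letters k i : seq (pedge G) :=
  [seq e <- enum (pedge G) |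
    (prod_order N (tag e) == k :> nat) && (node_order N (tag e) (tagged e) == i :> nat)].

Notation dec := (decode letters (cycles N)).
Notation word := (flat letters (cycles N)).

Lemma pe_pair_inj : injective (pe_pair N).
Proof.
move=> [k i] [k' j] [] /val_inj/rank_inj /= kk'; case: k' / kk' j => j.
by move=> /val_inj/rank_inj->.
Qed.

Lemma dec_pair e : dec (pe_pair N e) = [:: e].
Proof.
rewrite /= /letters -(filter_pred1_uniq (enum_uniq (pedge G)) (mem_enum _ e)).
apply: eq_filter => f /=; apply/andP/eqP => [[/eqP kE /eqP iE]|->//].
by apply: pe_pair_inj; rewrite /pe_pair kE iE.
Qed.

Lemma word_cons l ls : word (l :: ls) = dec l ++ word ls.
Proof. by []. Qed.

Lemma word_pair e ls : word (pe_pair N e :: ls) = e :: word ls.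
Proof. by rewrite word_cons dec_pair. Qed.

Definition vaddr (a : tree_vertex G) : addr G :=
  match a with TNode x => x | TRec x => x end.

Lemma node_cycle s : s < size (cycles N) -> is_cycle (nth [::] (cycles N) s).
Proof. by move=> sc; apply: (allP (cycles_sound N)); rewrite mem_nth. Qed.

Lemma cycle_word s t j e : s < size (cycles N) -> 
  let c := nth [::] (cycles N) s in t < size c -> dec (LRec s t j) = traject (next c) (nth e c t) j.
Proof.
move=> sc c tc; rewrite /= -/c modn_small //.
suff -> : onth c t = Some (nth e c t) by [].
by elim: c t tc {sc} => //= h c IH [].
Qed.

(** * Paths in the compressed parse tree *)

Section Tree.
Variables (g : graph G).

Lemma tree_path_inv a ls b : tree_path N g a ls b ->
  if ls is l :: ls' then exists2 c, tree_edge N g a l c & tree_path N g c ls' b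
  else a = b.
Proof. by case=> // {}a l c ls' {}b ac cb; exists c. Qed.

(** Cycle edges are followed only below recursive nodes: a node created along one has a recursive
    name and does not start a recursion. Hence [e] is off the cycles. *)
Lemma edge_TNode x l b : tree_edge N g (TNode x) l b -> exists e,
  [/\ l = pe_pair N e, occurs g (rcons x e), off_cycle e &
      b = (if `[< recursive G (pe_dst e) >] then @TRec _ _ G else @TNode _ _ G) (rcons x e)].
Proof.
move E : (TNode x) => a ab; case: ab E => // {a l b} [y e occ ne [->]|y e occ [re ne] [->]].
  exists e; split=> //; last by rewrite asboolF.
  by apply/asboolPn => -[c cc ec]; apply: ne; apply: cycle_recursive cc ec.
exists e; split=> //; first by apply/asboolPn; apply: ne.
by rewrite asboolT //; move: re; rewrite /node_name map_rcons last_rcons.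
Qed.

Lemma edge_TRec x l b : tree_edge N g (TRec x) l b -> exists s t j e,
  let c := nth [::] (cycles N) s in
  [/\ l = LRec s t j, s < size (cycles N), t < size c,
      pe_src (nth e c t) = node_name (start G) x &
      b = TNode (x ++ traject (next c) (nth e c t) j)].
Proof.
move E : (TRec x) => a ab; elim: ab x E => // {a l b}
  [y s t e occ st [sc [tc eE]] se _ [->]|x s t j y e ab IH occ [sc [tc eE]] _ [->]].
  exists s, t, 0, e; move: eE; rewrite addn0 modn_small // => eE.
  by split=> //; rewrite ?eE //= cats0.
have [_ [_ [_ [e' [[<- <- <-] _ _ sE [->]]]]]] := IH _ erefl.
have cu := cycle_uniq (node_cycle sc).
exists s, t, j.+1, e'; split=> //; congr (TNode _).
rewrite trajectSr rcons_cat (iter_next cu tc); congr (x ++ rcons _ _).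
by rewrite -[LHS]eE; apply: set_nth_default; rewrite ltn_mod (leq_ltn_trans _ tc).
Qed.

Lemma edge_TRec_word x l b : tree_edge N g (TRec x) l b -> exists s t j,
  [/\ b = TNode (x ++ dec (LRec s t j)), l = LRec s t j, s < size (cycles N) &
      t < size (nth [::] (cycles N) s)].
Proof.
case/edge_TRec=> [s [t [j [e [-> sc tc _ ->]]]]]; exists s, t, j.
by rewrite (cycle_word _ e).
Qed.

Lemma edge_vaddr a l b : tree_edge N g a l b -> vaddr b = vaddr a ++ dec l.
Proof.
case: a => x; first by move=> /edge_TNode[e [-> _ _ ->]]; rewrite dec_pair cats1; case: ifP.
move=> /edge_TRec[s [t [j [e [-> sc tc _ ->]]]]].
by rewrite (cycle_word _ e).
Qed.

Lemma path_vaddr a ls b : tree_path N g a ls b -> vaddr b = vaddr a ++ word ls.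
Proof.
elim=> {a ls b} [a|a l b ls c /edge_vaddr ab _ ->]; first by rewrite cats0.
by rewrite ab -catA.
Qed.

Lemma psi_word u ls : psi N g u ls -> u = word ls.
Proof. by case=> r [[_ ->]|[_ ->]] /path_vaddr. Qed.

(** Children of a recursive node are of the form [TNode], so recursive entries are never adjacent,
    and each other entry contributes an off-cycle letter. *)
Lemma path_size a ls b : tree_path N g a ls b ->
  size ls <= 2 * count (@off_cycle _ _ G) (word ls) + (if a is TRec _ then 1 else 0).
Proof.
elim=> {a ls b} [a|a l b ls c ab _ IH] //.
rewrite /flat /= count_cat -/(word ls); case: a ab => x.
  move=> /edge_TNode[e [-> _ ce bE]].
  rewrite dec_pair /= ce; move: IH; rewrite bE; case: ifP => _ /=; move: (count _ _); lia.
move=> /edge_TRec[s [t [j [e [_ _ _ _ bE]]]]]; move: IH; rewrite bE addn0.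
by move: (count _ _) (count _ (word ls)); lia.
Qed.

Lemma psi_size u ls : derives (start G) g -> u \in gnodes g -> psi N g u ls ->
  size ls <= 2 * #|Sigma| + 1.
Proof.
move=> dg ug pu; have := count_off_cycle (node_sorted dg ug); rewrite (psi_word pu).
case: pu => r _ /path_size; case: r => _; lia.
Qed.

Definition label_bound : nat :=
  (#|{: production G}| + \max_(k : production G) #|wnode (rhs k)| +
   size (cycles N) + #|{: pedge G}|).+1.

Lemma path_bounded a ls b : tree_path N g a ls b -> all (bounded label_bound) ls.
Proof.
elim=> {a ls b} [a|a l b ls c ab _ IH] //=; rewrite IH andbT; case: a ab => x.
  move=> /edge_TNode[[k i] [-> _ _ _]] /=.
  have kP : prod_order N k < #|{: production G}| by [].
  have iP : node_order N k i < #|wnode (rhs k)| by [].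
  have iW := leq_trans iP (@leq_bigmax _ (fun k : production G => #|wnode (rhs k)|) k).
  rewrite /label_bound -!addnA; apply/andP; split; apply: leqW.
    exact: leq_trans kP (leq_addr _ _).
  exact: leq_trans iW (leq_trans (leq_addr _ _) (leq_addl _ _)).
move=> /edge_TRec[s [t [j [e [-> sc tc _ _]]]]] /=.
have := cycle_size (node_cycle sc); rewrite /label_bound; lia.
Qed.

(** Both cycles pass through the name of [x], so strict linearity identifies them; the sources on a
    cycle are distinct, which fixes the start edge. *)
Lemma TRec_unique x s t j b s' t' j' b' :
  tree_edge N g (TRec x) (LRec s t j) b -> tree_edge N g (TRec x) (LRec s' t' j') b' ->
  s = s' /\ t = t'.
Proof.
move=> /edge_TRec[_ [_ [_ [e [[<- <- _] sc tc xE _]]]]].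
move=> /edge_TRec[_ [_ [_ [e' [[<- <- _] sc' tc' xE' _]]]]].
have cc := node_cycle sc; have cc' := node_cycle sc'.
have ss' : s = s'.
  have [s0 [_ uniq0]] := cycles_complete N cc.
  transitivity s0; first by symmetry; apply: uniq0; split=> //; exists 0; rewrite rot0.
  apply: uniq0; split=> //.
  have [//|/negP[]] := G_linear cc' cc.
  apply/hasP; exists (node_name (start G) x); first by rewrite -xE map_f // mem_nth.
  by rewrite inE -xE' map_f // mem_nth.
rewrite -ss' in tc' xE' *; split=> //; apply/eqP.
have /and3P[_ _ us] := cc.
rewrite -(nth_uniq (node_name (start G) x) _ _ us) ?size_map //.
by rewrite (nth_map e) // (nth_map e') // xE xE'.
Qed.

End Tree.

(** * Summaries and truncated indices *)

Section Answer.
Variables (A : dfa Gamma).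
Hypothesis A_safe : safe_dfa G A.
Implicit Types (q : state A).
Notation rels := {set state A * state A}.

Definition rel_post (I : rels) (R : state A -> state A -> Prop) : rels :=
  [set x | `[< exists2 q, (x.1, q) \in I & R q x.2 >]].
Definition rel_pre (R : state A -> state A -> Prop) (O : rels) : rels :=
  [set x | `[< exists2 q, R x.1 q & (q, x.2) \in O >]].
Definition rel_id : rels := [set x | x.1 == x.2].

(* The summary of a nonempty word consists of its first letter and of the ways
   in which a path may enter and leave along the rest of the word. *)
Definition summary : finType := option (pedge G * (rels * rels)).

Definition summary_step (z : summary) f : summary :=
  if z is Some (e, (i, o)) then
    Some (e, (rel_post i (@enter _ _ _ A f), rel_pre (@leave _ _ _ A f) o))
  else Some (f, (rel_id, rel_id)).

Definition summary_query (z1 z2 : summary) : bool :=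
  match z1, z2 with
  | Some (e, (_, o)), Some (f, (i, _)) =>
      `[< exists q1 q2 q3, [/\ (init A, q1) \in o, betw e f q1 q2,
                               (q2, q3) \in i & q3 \in final A] >]
  | _, _ => false
  end.

Lemma foldl_summary e I O b : foldl summary_step (Some (e, (I, O))) b =
  Some (e, (rel_post I (enters b), rel_pre (leaves b) O)).
Proof.
elim: b I O => [|f b IH] I O /=.
  congr (Some (_, (_, _))); apply/setP => -[q q']; rewrite inE /=.
    by apply/idP/asboolP => [qI|[q1 qI <-]//]; exists q'.
  by apply/idP/asboolP => [qO|[q1 -> //]]; exists q.
rewrite IH; congr (Some (_, (_, _))); apply/setP => -[q q']; rewrite !inE /=; apply/asboolP/asboolP.
- case=> q1; rewrite inE /= => /asboolP[q2 q2I f21] b1; exists q2 => //.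
  by exists q1.
- case=> q2 q2I [q1 f21 b1]; exists q1 => //; rewrite inE /=; apply/asboolP.
  by exists q2.
- case=> q1 b1; rewrite inE /= => /asboolP[q2 f12 q2O]; exists q2 => //.
  by exists q1.
case=> q2 [q1 b1 f12] q2O; exists q1 => //; rewrite inE /=; apply/asboolP.
by exists q2.
Qed.

Lemma summary_queryP e a f b :
  summary_query (foldl summary_step None (e :: a)) (foldl summary_step None (f :: b)) <->
  exists q, (exists q1 q2, [/\ leaves a (init A) q1, betw e f q1 q2 & enters b q2 q]) /\
    q \in final A.
Proof.
rewrite /= !foldl_summary /=; split.
  case/asboolP=> q1 [q2 [q3]]; rewrite !inE /= => -[/asboolP[q4 la]].
  rewrite inE /= => /eqP q41 ef /asboolP[q5]; rewrite inE /= => /eqP <- eb qF.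
  by exists q3; split=> //; exists q1, q2; rewrite -{1}q41.
case=> q [[q1 [q2 [la ef eb]]] qF]; apply/asboolP; exists q1, q2, q; split=> //.
  by rewrite inE; apply/asboolP; exists q1; rewrite // inE.
by rewrite inE; apply/asboolP; exists q2; rewrite // inE.
Qed.

Local Arguments summary_step : simpl never.

Notation ans := (answer letters (cycles N) summary_step None summary_query
  (init A \in final A)).

Definition truncate w (l : tree_label) : tree_label :=
  if l is LRec s t j then LRec s t (j %% 2 ^ w) else l.

(* On a cycle without branching productions the index may overflow a word, but
   then its letters act as identities and both labels carry the same index. *)
Definition truncatable w (l : tree_label) : bool :=
  if l is LRec s t j then
    has (@branching _ _ G) (nth [::] (cycles N) s) ==> (j < 2 ^ w)
  else true.

(** The only node of a right-hand side is its source. *)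
Lemma enter_nonbranching f q q' : ~~ branching f -> enter f q q' <-> q = q'.
Proof.
move=> nf; have [e se ef] := src_exists G_coarse (tag f).
have fE := nonbranching_eq nf (esym ef); rewrite -fE in se.
split=> [[[]//|[_ [_ [[_ _ nsf] _]]]]|]; [by rewrite se in nsf|by left].
Qed.

Lemma leave_nonbranching f q q' : ~~ branching f -> leave f q q' <-> q = q'.
Proof.
move=> nf; have [e se ef] := snk_exists G_coarse (tag f).
have fE := nonbranching_eq nf (esym ef); rewrite -fE in se.
split=> [[[]//|[_ [_ [[_ _ nsf] _]]]]|]; [by rewrite se in nsf|by left].
Qed.

Lemma nonbranching_step z e f : ~~ branching f ->
  summary_step (Some (e, z)) f = Some (e, z).
Proof.
case: z => I O nf; rewrite /summary_step.
congr (Some (_, (_, _))); apply/setP => -[q q']; rewrite inE /=.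
  apply/asboolP/idP => [[q1 qI /(enter_nonbranching _ _ nf) <-]//|qI].
  by exists q' => //; apply/(enter_nonbranching _ _ nf).
apply/asboolP/idP => [[q1 /(leave_nonbranching _ _ nf) <-]//|qI].
by exists q => //; apply/(leave_nonbranching _ _ nf).
Qed.

(** Truncation may delete letters of a nonbranching cycle. This is harmless only after a first
    letter has been recorded, hence the initial summary [Some (e, z)]. *)
Lemma foldl_truncate g w a ls b z e : tree_path N g a ls b -> all (truncatable w) ls ->
  foldl summary_step (Some (e, z)) (word (map (truncate w) ls)) =
  foldl summary_step (Some (e, z)) (word ls).
Proof.
move=> p; elim: p z => {a ls b} [|a l b ls c ab _ IH] z //= /andP[tl tls].
rewrite /flat /= !foldl_cat -/(word ls) -/(word (map (truncate w) ls)).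
have -> : foldl summary_step (Some (e, z)) (dec (truncate w l)) =
          foldl summary_step (Some (e, z)) (dec l).
  case: a ab => x; first by move=> /edge_TNode[f [-> _ _ _]].
  move=> /edge_TRec[s [t [j [f [lE sc tc _ _]]]]]; rewrite {}lE in tl *.
  rewrite [truncate _ _]/= !(cycle_word _ f) //.
  have [br|nb] := boolP (has (@branching _ _ G) (nth [::] (cycles N) s)).
    by move: tl; rewrite /= br => /= jw; rewrite modn_small.
  have triv j' : foldl summary_step (Some (e, z))
      (traject (next (nth [::] (cycles N) s)) (nth f (nth [::] (cycles N) s) t) j') = Some (e, z).
    have: nth f (nth [::] (cycles N) s) t \in nth [::] (cycles N) s by rewrite mem_nth.
    elim: j' (nth f _ t) => //= j' IHj f' fc.
    rewrite nonbranching_step; first by rewrite IHj // mem_next.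
    by apply: (hasPn nb).
  by rewrite !triv.
case: z {IH}(IH) => I O IH.
by rewrite foldl_summary IH.
Qed.

Lemma query_reach (R : regex Gamma) g u v : dfa_accepts A R ->
  query R g u v <-> exists2 q, reach g u v (init A) q & q \in final A.
Proof.
move=> AR; split=> [[p uv /AR pF]|[q /reachP[p uv <-] pF]].
  by exists (trans_star (init A) (path_tags p)) => //; apply/reachP; exists p.
by exists p => //; apply/AR.
Qed.

Section Run.
Variables (g : graph G) (rg : run g) (w : nat).
Let dg : derives (start G) g := rg.1.

Lemma not_below u e : u \in gnodes g -> ~ occ g (rcons u e).
Proof. by move=> ug [b]; rewrite cat_rcons => /(antichain dg ug). Qed.

Lemma summary_answer p e a f b u v lu lv : u \in gnodes g -> v \in gnodes g ->
  u = p ++ e :: a -> v = p ++ f :: b -> e != f ->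
  foldl summary_step None (word lu) = foldl summary_step None (e :: a) ->
  foldl summary_step None (word lv) = foldl summary_step None (f :: b) ->
  (exists2 q, reach g u v (init A) q & q \in final A) <->
  summary_query (summ letters (cycles N) summary_step None lu)
                (summ letters (cycles N) summary_step None lv).
Proof.
move=> ug vg uE vE ef lE lE'; rewrite /summ lE lE' summary_queryP.
rewrite uE in ug *; rewrite vE in vg *.
have splitE q := reach_split N G_coarse A_safe rg (init A) q ef ug vg.
split=> [[q /splitE]|[q [/splitE]]]; first by exists q.
by exists q.
Qed.

Lemma occurs_vaddr a ls u : tree_path N g a ls (TNode u) -> u \in gnodes g ->
  occ g (vaddr a).
Proof. by move=> /path_vaddr /= -> ug; exists (word ls). Qed.

(** The situation where the recursion goes on along [e] at [y], but [u] is not reached along [e].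
    The next letter of [u] is off the cycles, so it differs from [e], yet it belongs to the same
    production. *)
Lemma leave_cycle y lu u e : tree_path N g (TNode y) lu (TNode u) ->
  u \in gnodes g -> occ g (rcons y e) -> on_cycle e ->
  exists f lu' c, [/\ lu = pe_pair N f :: lu', tree_path N g c lu' (TNode u),
    f != e, tag f = tag e & u = y ++ f :: word lu'].
Proof.
move=> yu ug ye ce; have uE := path_vaddr yu.
case: lu yu uE => [|l lu] yu uE; have := tree_path_inv yu.
  by case=> yE; rewrite yE in ye; case: (not_below ug ye).
case=> c /edge_TNode[f [lE _ nf _]] cu.
rewrite {}lE word_pair /= in yu uE *.
exists f, lu, c; split=> //; first by apply/eqP => fe; move: nf; rewrite fe => /asboolPn.
by case: ye => b; rewrite cat_rcons; rewrite uE in ug; apply: consistent dg _ _ _ _ _ ug.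
Qed.

Lemma foldl_pair c lu b e : tree_path N g c lu b -> all (truncatable w) lu ->
  foldl summary_step None (word (pe_pair N e :: map (truncate w) lu)) =
  foldl summary_step None (e :: word lu).
Proof.
move=> cu tu; rewrite word_pair.
exact: foldl_truncate cu tu.
Qed.

Lemma foldl_first e a c lu b : tree_path N g c lu b -> all (truncatable w) lu ->
  foldl summary_step None ((e :: a) ++ word (map (truncate w) lu)) =
  foldl summary_step None (e :: a ++ word lu).
Proof.
move=> cu tu; rewrite -cat_cons !foldl_cat /= /summary_step foldl_summary.
exact: foldl_truncate cu tu.
Qed.

Lemma dec_split s t j d : s < size (cycles N) -> t < size (nth [::] (cycles N) s) ->
  exists e a, [/\ dec (LRec s t (j + d.+1)) = dec (LRec s t j) ++ e :: a,
    dec (LRec s (t + j) d.+1) = e :: a & e \in nth [::] (cycles N) s].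
Proof.
move=> sc tc; case E: (nth [::] (cycles N) s) (tc) => [//|e0 c0] _; rewrite -{}E.
set c := nth [::] (cycles N) s in tc *.
have cu : uniq c := cycle_uniq (node_cycle sc).
exists (iter j (next c) (nth e0 c t)).
exists (traject (next c) (next c (iter j (next c) (nth e0 c t))) d).
have tj : (t + j) %% size c < size c by rewrite ltn_mod (leq_ltn_trans _ tc).
split.
- by rewrite !(cycle_word _ e0) // trajectD.
- have -> : dec (LRec s (t + j) d.+1) = dec (LRec s ((t + j) %% size c) d.+1).
    by rewrite /= modn_mod.
  by rewrite (cycle_word _ e0) // (iter_next cu tc).
by rewrite (iter_next cu tc) mem_nth.
Qed.

Lemma answerP a lu lv u v : u \in gnodes g -> v \in gnodes g ->
  tree_path N g a lu (TNode u) -> tree_path N g a lv (TNode v) ->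
  all (truncatable w) lu -> all (truncatable w) lv ->
  (exists2 q, reach g u v (init A) q & q \in final A) <->
  ans (map (truncate w) lu) (map (truncate w) lv).
Proof.
move=> ug vg; elim: lu lv a => [|l lu IH] [|l' lv] a au av.
- move: (tree_path_inv au) (tree_path_inv av) => /= -> [->] _ _.
  split=> [[q /(reach_same N G_coarse dg) <-]//|iF].
  by exists (init A) => //; apply: reach_nil.
(* One label cannot end before the other, since a node of the run has nothing below it. *)
- move: (tree_path_inv au) (tree_path_inv av) => /= aE [c].
  rewrite aE => /edge_TNode[e [_ _ _ ->]] /occurs_vaddr/(_ vg).
  by case: ifP => _ /(not_below ug).
- move: (tree_path_inv av) (tree_path_inv au) => /= aE [c].
  rewrite aE => /edge_TNode[e [_ _ _ ->]] /occurs_vaddr/(_ ug).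
  by case: ifP => _ /(not_below vg).
move: (tree_path_inv au) (tree_path_inv av) => [b ab bu] [b' ab' bv'] /=.
have vE := path_vaddr av; have uE := path_vaddr au.
case: a ab ab' {au av} uE vE => x ab ab' /= uE vE.
  case: (edge_TNode ab) => e [lE _ _ bE]; case: (edge_TNode ab') => f [lE' _ _ bE'].
  move: bE bE' uE vE; rewrite {}lE {}lE' => bE bE' uE vE /= tu tv.
  have -> : ((prod_order N (tag e) == prod_order N (tag f) :> nat) &&
      (node_order N (tag e) (tagged e) == node_order N (tag f) (tagged f) :> nat)) = (e == f).
    apply/andP/eqP => [[/eqP kE /eqP iE]|->//].
    by apply: pe_pair_inj; rewrite /pe_pair kE iE.
  have [ef|nef] := eqVneq e f.
    by apply: IH bu _ tu tv; rewrite bE ef -bE'.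
  rewrite word_pair in uE.
  rewrite word_pair in vE.
  apply: (summary_answer ug vg uE vE nef).
    exact: foldl_pair bu tu.
  exact: foldl_pair bv' tv.
have [s [t [j [bE lE sc tc]]]] := edge_TRec_word ab.
have [s' [t' [j' [bE' lE' _ _]]]] := edge_TRec_word ab'.
rewrite lE in ab uE *; rewrite lE' in ab' vE *.
have [ss tt] := TRec_unique ab ab'; rewrite -{}ss -{}tt in ab' vE bE' lE' * => {s' t'}.
rewrite word_cons in uE; rewrite word_cons in vE.
have cc := node_cycle sc.
rewrite {}bE in bu; rewrite {}bE' in bv'.
case: (ltngtP j j') => [lt_j|gt_j|eq_j]; last 1 first.
(* Equal indices remain equal after truncation, even if they overflow. *)
- rewrite -eq_j in bv' * => /= /andP[_ tu] /andP[_ tv]; rewrite eqxx.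
  exact: IH bu bv' tu tv.
- have [e [a [splitE dE ec]]] := dec_split j (j' - j).-1 sc tc.
  rewrite prednK ?subn_gt0 // subnKC ?(ltnW lt_j) // in splitE dE.
  have vE' : v = (x ++ dec (LRec s t j)) ++ e :: a ++ word lv.
    by rewrite vE splitE -!catA.
  have ye : occ g (rcons (x ++ dec (LRec s t j)) e).
    by exists (a ++ word lv); rewrite cat_rcons -vE'.
  have ce : on_cycle e by exists (nth [::] (cycles N) s).
  have [f [lu' [c [luE cu fe tagE uE']]]] := leave_cycle bu ug ye ce.
  (* [e] and [f] are two nodes of one right-hand side, so the cycle is branching; both indices then
     fit in a word and truncation preserves their order. *)
  have br : has (@branching _ _ G) (nth [::] (cycles N) s).
    apply/hasP; exists e => //; apply: contraNT fe => nb.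
    by apply/eqP; symmetry; apply: nonbranching_eq nb (esym tagE).
  rewrite /= br /= => /andP[jw tu] /andP[jw' tv].
  rewrite !modn_small // ltn_eqF // lt_j.
  apply: (summary_answer ug vg uE' vE' fe).
    rewrite luE in tu *; exact: foldl_pair cu tu.
  rewrite word_cons dE; exact: foldl_first bv' tv.
have [e [a [splitE dE ec]]] := dec_split j' (j - j').-1 sc tc.
rewrite prednK ?subn_gt0 // subnKC ?(ltnW gt_j) // in splitE dE.
have uE' : u = (x ++ dec (LRec s t j')) ++ e :: a ++ word lu.
  by rewrite uE splitE -!catA.
have ye : occ g (rcons (x ++ dec (LRec s t j')) e).
  by exists (a ++ word lu); rewrite cat_rcons -uE'.
have ce : on_cycle e by exists (nth [::] (cycles N) s).
have [f [lv' [c [lvE cv fe tagE vE']]]] := leave_cycle bv' vg ye ce.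
have br : has (@branching _ _ G) (nth [::] (cycles N) s).
  apply/hasP; exists e => //; apply: contraNT fe => nb.
  by apply/eqP; symmetry; apply: nonbranching_eq nb (esym tagE).
rewrite /= br /= => /andP[jw tu] /andP[jw' tv].
rewrite !modn_small // gtn_eqF // ltnNge (ltnW gt_j) /=.
rewrite eq_sym in fe.
apply: (summary_answer ug vg uE' vE' fe).
  rewrite word_cons dE; exact: foldl_first bu tu.
rewrite lvE in tv *; exact: foldl_pair cv tv.
Qed.

End Run.
End Answer.
End TreeLabels.

Lemma encode_truncate C w ls : C <= 2 ^ w -> 1 < 2 ^ w -> size ls < 2 ^ w ->
  all (bounded C) ls ->
  [seq x %% 2 ^ w | x <- encode_label ls] = encode_label (map (truncate w) ls).
Proof.
move=> Cw w1 sw; rewrite /encode_label /= modn_small // size_map; move=> bls; congr (_ :: _).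
elim: ls bls {sw} => //= l ls IH /andP[bl /IH bls]; rewrite map_cat {}bls; congr (_ ++ _).
case: l bl => [k i|s t j] /= /andP[b1 b2]; rewrite ?mod0n.
  by rewrite !modn_small ?(leq_trans _ Cw).
by rewrite (modn_small w1) (modn_small (leq_trans b1 Cw)) (modn_small (leq_trans b2 Cw)).
Qed.

Lemma load_input_truncate C w lu lv : C <= 2 ^ w -> 1 < 2 ^ w ->
  size lu < 2 ^ w -> size lv < 2 ^ w -> all (bounded C) lu -> all (bounded C) lv ->
  load_input w (encode_label lu ++ encode_label lv) =
  label_memory (map (truncate w) lu) (map (truncate w) lv).
Proof.
move=> Cw w1 su sv bu bv; apply/funext => a; rewrite /load_input /label_memory.
rewrite -!(@encode_truncate C) // -map_cat.
case: (ltnP a (size (encode_label lu ++ encode_label lv))) => sa.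
  by rewrite (nth_map 0).
by rewrite !nth_default ?size_map // mod0n.
Qed.

Lemma bounded_truncate C w ls : all (bounded C) ls -> all (bounded C) (map (truncate w) ls).
Proof. by rewrite all_map; apply: sub_all => -[]. Qed.

(** Each turn of a branching cycle uses up one of fewer than [n] branching letters, so the index is
    below [n] times the cycle length. *)
Lemma path_truncatable (Sigma Gamma : finType) (G : grammar Sigma Gamma) (N : numbering G)
    (g : graph G) n w a ls b : n * #|{: pedge G}| <= 2 ^ w -> tree_path N g a ls b ->
  count (@branching _ _ G) (flat (letters N) (cycles N) ls) < n -> all (truncatable N w) ls.
Proof.
move=> nw; elim=> {a ls b} [a|a l b ls c ab _ IH] //.
rewrite word_cons count_cat /= => ltn; rewrite IH ?(leq_ltn_trans _ ltn) ?leq_addl // andbT.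
have {ltn IH} ltn := leq_ltn_trans (leq_addr _ _) ltn; case: a ab => x.
  by move=> /edge_TNode[e [-> _ _ _]].
move=> /edge_TRec[s [t [j [e [lE sc tc _ _]]]]]; rewrite {}lE /= in ltn *.
apply/implyP => br; have cc := node_cycle sc.
rewrite -/(decode (letters N) (cycles N) (LRec s t j)) (cycle_word _ e) // in ltn.
have := leq_ltn_trans (count_traject_next (cycle_uniq cc) tc e j br) ltn.
rewrite ltn_divLR ?(leq_ltn_trans _ tc) // => jn.
apply: leq_trans jn (leq_trans _ nw); by rewrite leq_mul2l cycle_size ?orbT.
Qed.

Theorem theorem1 (Sigma Gamma : finType) (G : grammar Sigma Gamma)
    (N : numbering G) (R : regex Gamma)
    (G_coarse : coarse_grained G) (G_linear : strictly_linear G)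
    (R_safe : safe G R) :
  exists (prog : seq instr) (time w0 : nat),
  forall (g : graph G), run g ->
  forall (u v : addr G) (lu lv : seq tree_label),
  u \in gnodes g -> v \in gnodes g -> psi N g u lu -> psi N g v lv ->
  exists b : bool,
    computes (up_log 2 #|` gnodes g| + w0) prog time
      (encode_label lu ++ encode_label lv) b /\
    (b <-> query R g u v).
Proof.
have [A AR A_safe] := R_safe.
pose n := 2 * #|Sigma| + 1.
pose C := label_bound N.
pose c := #|{: pedge G * summary G A}|.
(* [K] exceeds [n] and [C], so lengths and bounded entries are recovered exactly, and [c], so
   iterations on pairs (letter, summary) have entered their loops. *)
pose K := (n + C + c).+2.
(* The factorial is divisible by every period up to [c] and by every cycle length. *)
pose P := (c + #|{: pedge G}|)`!.
pose w0 := n + C.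
(* The run is existential and [w] only bounded below, so a single table covers all runs. *)
pose instance w inp (b : bool) := exists (g : graph G) u v lu lv,
  [/\ run g, u \in gnodes g /\ v \in gnodes g, psi N g u lu /\ psi N g v lv,
      up_log 2 #|` gnodes g| + w0 <= w /\ inp = encode_label lu ++ encode_label lv &
      b <-> query R g u v].
pose ans := answer (letters N) (cycles N) (@summary_step _ _ G A) None
  (@summary_query _ _ G A) (init A \in final A).
have instanceP w inp b : instance w inp b -> exists lu lv,
  [/\ size lu <= n /\ size lv <= n, all (bounded C) lu /\ all (bounded C) lv,
     load_input w inp = label_memory lu lv & b = ans lu lv].
  case=> g [u [v [lu [lv [rg [ug vg] [pu pv] [le_w inpE] bE]]]]].
  have dg := rg.1.
  have su := psi_size dg ug pu; have sv := psi_size dg vg pv.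
  have [ru rootu pathu] := pu; have [rv rootv pathv] := pv.
  have bu := path_bounded pathu; have bv := path_bounded pathv.
  have w0w : w0 < 2 ^ w.
    apply: leq_ltn_trans (ltn_expl w (isT : 1 < 2)).
    exact: leq_trans (leq_addl _ _) le_w.
  have Cw : C <= 2 ^ w by apply: leq_trans (ltnW w0w); apply: leq_addl.
  have nw : n < 2 ^ w by apply: leq_ltn_trans w0w; apply: leq_addr.
  have w1 : 1 < 2 ^ w by apply: leq_ltn_trans nw; rewrite /n addn1.
  exists (map (truncate w) lu), (map (truncate w) lv); split.
  - by rewrite !size_map.
  - by split; apply: bounded_truncate.
  - by rewrite inpE (@load_input_truncate C) // ?(leq_ltn_trans _ nw).
  (* The [up_log] part of [w] yields a factor of at least the run size, and [w0] one of at least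
     [#|{: pedge G}|]. *)
  have cw : #|` gnodes g| * #|{: pedge G}| <= 2 ^ w.
    apply: leq_trans (leq_pexp2l _ le_w) => //; rewrite expnD leq_mul ?up_logP //.
    apply: leq_trans (ltnW (ltn_expl w0 (isT : 1 < 2))).
    by rewrite /w0 /C /label_bound -addnS; do 2 apply: leq_trans (leq_addl _ _); apply: leqnSn.
  (* The root is unique, so both labels can be followed from a common vertex. *)
  have rE : ru = rv.
    by case: rootu rootv => -[s ->] [] [s' ->].
  have tu : all (truncatable N w) lu.
    by apply: path_truncatable cw pathu _; rewrite -(psi_word pu); apply: count_branching dg _ ug.
  have tv : all (truncatable N w) lv.
    by apply: path_truncatable cw pathv _; rewrite -(psi_word pv); apply: count_branching dg _ vg.
  rewrite -rE in pathv.
  have aE := answerP G_coarse G_linear A_safe rg ug vg pathu pathv tu tv.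
  by apply/idP/idP => [/bE/(query_reach _ _ _ AR)/aE|/aE/(query_reach _ _ _ AR)/bE].
have P0 : 0 < P by apply: fact_gt0.
have K1 : 1 < K by [].
have inv w1 w2 in1 in2 b1 b2 : instance w1 in1 b1 -> instance w2 in2 b2 ->
    csim (8 * n).+3 K P (load_input w1 in1) (load_input w2 in2) -> b1 = b2.
  move=> /instanceP[lu1 [lv1 [[su1 sv1] [bu1 bv1] -> ->]]].
  move=> /instanceP[lu2 [lv2 [[su2 sv2] [bu2 bv2] -> ->]]] sim.
  have CK : C <= K by rewrite /K; lia.
  have nK : n < K by rewrite /K; lia.
  have cK : c <= K by rewrite /K; lia.
  have [s1 s2 s3] := csim_labels (cycles N) CK nK K1 su1 sv1 su2 sv2 bu1 bv1 sim.
  apply: answer_sim s1 s2 s3 => //.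
    by move=> d /andP[d0 dc]; apply: dvdn_fact; rewrite d0 (leq_trans dc) // leq_addr.
  move=> d dN d0; apply: dvdn_fact; rewrite d0 /=.
  apply: leq_trans (leq_addl _ _); apply: cycle_size.
  exact: (allP (cycles_sound N)).
have [prog [time [w1 progP]]] := csim_computable P0 inv.
exists prog, time, (w0 + w1) => g rg u v lu lv ug vg pu pv.
exists `[< query R g u v >]; split; last by split=> /asboolP.
apply: progP; first by rewrite addnA leq_addl.
exists g, u, v, lu, lv; split=> //; last by split=> /asboolP.
by rewrite addnA leq_addr.
Qed.
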